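(* Let $\mathcal{KT}$ be the category of compact toposets with continuous isotone maps, and $\mathrm{ab}\text{-}\mathcal{IC}$ the category of $I^*$-algebras $(I,C)$ with $C$ abelian, with $I^*$-morphisms. Let $\mathcal I:\mathcal{KT}\to\mathrm{ab}\text{-}\mathcal{IC}$ be the contravariant functor $\mathcal I(M)=(I(M),\mathcal C(M))$, $\mathcal I(f)=f^*:g\mapsto g\circ f$, and let $\widehat{\ }:\mathrm{ab}\text{-}\mathcal{IC}\to\mathcal{KT}$ be the contravariant functor sending $(I,C)$ to $(\hat C,\le_I)$ and a morphism $\phi:(I,C)\to(I',C')$ to the pullback $\hat\phi:\hat C'\to\hat C$, $m\mapsto m\circ\phi$. Then the functors $\widehat{\ }$ and $\mathcal I$ realize a dual equivalence between $\mathrm{ab}\text{-}\mathcal{IC}$ and $\mathcal{KT}$; that is, they are inverse to each other up to natural isomorphisms.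
   Context: An ordered topological space is a set $M$ with a partial order $\le$ and a topology. A map $f$ between ordered sets is isotone if $x\le y\Rightarrow f(x)\le f(y)$. $I(M)$ is the set of continuous isotone functions $M\to\mathbb R$. A toposet is an ordered topological space $M$ such that for all $x,y\in M$: $x\le y\Leftrightarrow\forall f\in I(M),\ f(x)\le f(y)$. $\mathcal C(M)$ is the algebra of continuous functions $M\to\mathbb C$. For a unital $C^*$-algebra $C$, let $\mathrm{Re}\,C=\{a\in C: a=a^*\}$, $|a|=\sqrt{a^*a}$, and for $a,b\in\mathrm{Re}\,C$ put $a\wedge b=\frac{a+b}{2}-\frac{|a-b|}{2}$, $a\vee b=\frac{a+b}{2}+\frac{|a-b|}{2}$. A pre-isocone of $C$ is a norm-closed subset $I\subset\mathrm{Re}\,C$ stable under addition, under multiplication by reals $\lambda\ge0$, under $\wedge$ and $\vee$, and containing $x1$ for all $x\in\mathbb R$. It is an isocone if moreover its complex linear span is dense in $C$. An $I^*$-algebra is a couple $(I,C)$ with $C$ a unital $C^*$-algebra and $I$ an isocone of $C$. An $I^*$-morphism $(I,C)\to(I',C')$ is a unital $*$-morphism $\rho:C\to C'$ with $\rho(I)\subset I'$ and such that $\rho(J)$ is closed for every pre-isocone $J\subset I$ of $C$. $\hat C$ is the character space of the abelian algebra $C$ (unital $*$-morphisms $C\to\mathbb C$) with the weak-$*$ topology, and $m\le_I n\Leftrightarrow\forall c\in I,\ m(c)\le n(c)$. *)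

(* Defs.v *)
From HB Require Import structures.
From mathcomp Require Import all_boot all_order all_algebra.
From mathcomp Require Import complex.
From mathcomp Require Import all_classical reals topology normedtype sequences.

Set Implicit Arguments.
Unset Strict Implicit.
Unset Printing Implicit Defensive.
Import Order.TTheory GRing.Theory Num.Theory.
Import numFieldNormedType.Exports.
Local Open Scope classical_set_scope.
Local Open Scope ring_scope.
Local Open Scope complex_scope.

Section complex_topology.
Context {R : realType}.
HB.instance Definition _ := NormedModule.copy R[i] R[i]^o.
Lemma complex_complete (F : set_system R[i]) : ProperFilter F -> cauchy F -> cvg F.
Proof.
move=> FF /cauchy_ballP cF.
have P1 (f : R[i] -> R) : (forall x y, `|f x - f y|%:C <= `|x - y|) -> cvg (f @ F).
  move=> hf; apply: cauchy_cvg; apply/cauchy_ballP => e e0.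
  have /= := cF e%:C; rewrite ltcR => /(_ e0).
  rewrite !near_simpl; apply: filterS => -[x y] /=.
  rewrite -!ball_normE /= => h; rewrite -ltcR; exact: le_lt_trans (hf _ _) h.
have hRe : cvg (@complex.Re R @ F).
  by apply: P1 => x y; apply: le_trans (normc_ge_Re _); case: x y => [? ?][? ?].
have hIm : cvg (@complex.Im R @ F).
  apply: P1 => x y.
  suff h : forall z : R[i], `|complex.Im z|%:C <= `|z|.
    by apply: le_trans (h _); case: x y => [? ?][? ?].
  move=> z; have := normc_ge_Re (z * 'i); rewrite ReiNIm normrN normrM.
  suff -> : `|'i%C : R[i]| = 1 by rewrite mulr1.
  by rewrite normc_def /= expr0n expr1n add0r sqrtr1.
apply/cvg_ex; exists (lim (@complex.Re R @ F) +i* lim (@complex.Im R @ F)).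
apply/cvgrPdist_lt => e e0.
have [e' ee'] : exists e', e = e'%:C by move: e e0 => [a b]; rewrite ltcE /= => /andP[/eqP ->]; exists a.
have e'0 : 0 < e' / 2 by rewrite divr_gt0 // -ltcR -ee'.
near=> z.
have hr : `|lim (@complex.Re R @ F) - complex.Re z| < e' / 2.
  by near: z; move/cvgrPdist_lt: hRe => /(_ _ e'0).
have hi : `|lim (@complex.Im R @ F) - complex.Im z| < e' / 2.
  by near: z; move/cvgrPdist_lt: hIm => /(_ _ e'0).
rewrite ee'.
set a := lim _ in hr *; set b := lim _ in hi *.
have -> : a +i* b - z = (a - complex.Re z)%:C + 'i * (b - complex.Im z)%:C.
  by rewrite {1}[z]complexE; move: (complex.Re z) (complex.Im z) => x y; simpc.
apply: le_lt_trans (ler_normD _ _) _.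
rewrite normrM (_ : `|'i%C : R[i]| = 1) ?mul1r; last first.
  by rewrite normc_def /= expr0n expr1n add0r sqrtr1.
rewrite !normc_def /= !expr0n !addr0 !sqrtr_sqr.
rewrite -rmorphD /= ltcR [e']splitr; exact: ltrD.
Unshelve. all: by end_near. Qed.
HB.instance Definition _ := Uniform_isComplete.Build R[i] complex_complete.
End complex_topology.

(* A unital C*-algebra over R[i]. The zero algebra (1 = 0) is allowed: it is the
   algebra of continuous functions on the empty space. This rules out the
   library's algType, whose rings are nontrivial, and HB accepts no structure
   joining possibly trivial rings with normed modules; hence a record over a
   Banach space, whose carrier then gets both library structures. *)
Record cstarAlgType (R : realType) := CStarAlgebra {
  cstar_banach : completeNormedModType R[i];
  cstar_one : cstar_banach;
  cstar_mul : cstar_banach -> cstar_banach -> cstar_banach;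
  cstar_star : cstar_banach -> cstar_banach;
  cstar_mulA : associative cstar_mul;
  cstar_mul1l : left_id cstar_one cstar_mul;
  cstar_mul1r : right_id cstar_one cstar_mul;
  cstar_mulDl : left_distributive cstar_mul +%R;
  cstar_mulDr : right_distributive cstar_mul +%R;
  cstar_scaleAl : forall (k : R[i]) a b,
    k *: cstar_mul a b = cstar_mul (k *: a) b;
  cstar_scaleAr : forall (k : R[i]) a b,
    k *: cstar_mul a b = cstar_mul a (k *: b);
  cstar_normM : forall a b, `|cstar_mul a b| <= `|a| * `|b|;
  cstar_starK : involutive cstar_star;
  cstar_starD : {morph cstar_star : a b / a + b};
  cstar_starZ : forall (k : R[i]) a,
    cstar_star (k *: a) = (k^*)%R *: cstar_star a;
  cstar_starM : forall a b,
    cstar_star (cstar_mul a b) = cstar_mul (cstar_star b) (cstar_star a);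
  cstar_normE : forall a, `|cstar_mul (cstar_star a) a| = `|a| ^+ 2
}.

Definition cstar_sort (R : realType) (A : cstarAlgType R) : Type :=
  cstar_banach A.
Coercion cstar_sort : cstarAlgType >-> Sortclass.

HB.instance Definition _ (R : realType) (A : cstarAlgType R) :=
  CompleteNormedModule.copy (cstar_sort A) (cstar_banach A).
HB.instance Definition _ (R : realType) (A : cstarAlgType R) :=
  GRing.Zmodule_isPzRing.Build (cstar_sort A)
    (@cstar_mulA R A) (@cstar_mul1l R A) (@cstar_mul1r R A)
    (@cstar_mulDl R A) (@cstar_mulDr R A).

Definition star (R : realType) (A : cstarAlgType R) (a : A) : A := cstar_star a.

Section continuous_functions.
Context {R : realType}.

(* C(M) for a compact space M; the proof cM only serves as a key, so that the
   sup-norm structure is attached to compact spaces alone. *)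
Definition Cfun (M : topologicalType) (cM : compact [set: M]) : Type :=
  continuousType M R[i].

Section algebra.
Context {M : topologicalType} (cM : compact [set: M]).
Local Notation C := (Cfun cM).
Implicit Types (f g h : C) (k : R[i]) (x : M).

Definition Cval f : M -> R[i] := f : continuousType M R[i].
Definition mkC (f : M -> R[i]) (cf : continuous f) : C :=
  (mkcts cf : continuousType M R[i]).

Lemma CvalP f g : (forall x, Cval f x = Cval g x) -> f = g.
Proof. by move=> fg; apply/continuousEP. Qed.

Lemma Cval_continuous f x : Cval f y @[y --> x] --> Cval f x.
Proof. exact: (@cts_fun _ _ (f : continuousType M R[i])). Qed.

Definition Cconst k : C := mkC (@cst_continuous M R[i] k).

Lemma Cadd_subproof f g : continuous (fun x => Cval f x + Cval g x).
Proof. by move=> x; apply: cvgD; exact: Cval_continuous. Qed.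
Definition Cadd f g := mkC (@Cadd_subproof f g).

Lemma Copp_subproof f : continuous (fun x => - Cval f x).
Proof. by move=> x; apply: cvgN; exact: Cval_continuous. Qed.
Definition Copp f := mkC (@Copp_subproof f).

Lemma Cmul_subproof f g : continuous (fun x => Cval f x * Cval g x).
Proof. by move=> x; apply: cvgM; exact: Cval_continuous. Qed.
Definition Cmul f g := mkC (@Cmul_subproof f g).

Lemma Cstar_subproof f : continuous (fun x => ((Cval f x)^*)%R).
Proof.
move=> x; apply/cvgrPdist_lt => e e0; near=> y.
rewrite -rmorphB norm_conjC; near: y.
by move/cvgrPdist_lt: (@Cval_continuous f x); apply.
Unshelve. all: by end_near. Qed.
Definition Cstar f := mkC (@Cstar_subproof f).

HB.instance Definition _ := Choice.copy C (continuousType M R[i]).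

Fact CaddA : associative Cadd.
Proof. by move=> f g h; apply: CvalP => x; exact: addrA. Qed.
Fact CaddC : commutative Cadd.
Proof. by move=> f g; apply: CvalP => x; exact: addrC. Qed.
Fact Cadd0 : left_id (Cconst 0) Cadd.
Proof. by move=> f; apply: CvalP => x; exact: add0r. Qed.
Fact CaddN : left_inverse (Cconst 0) Copp Cadd.
Proof. by move=> f; apply: CvalP => x; exact: addNr. Qed.
HB.instance Definition _ := GRing.isZmodule.Build C CaddA CaddC Cadd0 CaddN.

Definition Cscale k f := Cmul (Cconst k) f.
Fact CscaleA k l f : Cscale k (Cscale l f) = Cscale (k * l) f.
Proof. by apply: CvalP => x; exact: mulrA. Qed.
Fact Cscale1 : left_id 1 Cscale.
Proof. by move=> f; apply: CvalP => x; exact: mul1r. Qed.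
Fact CscaleDr : right_distributive Cscale +%R.
Proof. by move=> k f g; apply: CvalP => x; exact: mulrDr. Qed.
Fact CscaleDl f : {morph Cscale^~ f : k l / k + l}.
Proof. by move=> k l; apply: CvalP => x; exact: mulrDl. Qed.
HB.instance Definition _ :=
  GRing.Zmodule_isLmodule.Build R[i] C CscaleA Cscale1 CscaleDr CscaleDl.

(* On the empty space the supremum is [sup set0 = 0]. *)
Definition Csupnorm f : R := sup (range (fun x => Normc.normc (Cval f x))).

Lemma normcE (z : R[i]) : `|z| = (Normc.normc z)%:C.
Proof. by []. Qed.

Lemma normc_continuous f x :
  Normc.normc (Cval f y) @[y --> x] --> Normc.normc (Cval f x).
Proof.
apply/cvgrPdist_lt => e e0; near=> y.
have : `|Cval f x - Cval f y| < e%:C.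
  by near: y; move/cvgrPdist_lt: (@Cval_continuous f x); apply; rewrite ltcR.
move=> /(le_lt_trans (ler_dist_dist _ _)).
by rewrite (normcE (Cval f x)) (normcE (Cval f y)) -rmorphB normc_def /= expr0n addr0 sqrtr_sqr ltcR.
Unshelve. all: by end_near. Qed.

Lemma le_Csupnorm f x : Normc.normc (Cval f x) <= Csupnorm f.
Proof.
apply: sup_upper_bound; last by exists x.
split; first by exists (Normc.normc (Cval f x)), x.
have /compact_bounded : compact (range (fun x => Normc.normc (Cval f x))).
  apply: continuous_compact cM.
  exact: continuous_subspaceT (@normc_continuous f).
move=> [B [_ BP]]; exists (B + 1) => _ [y _ <-].
have := BP (B + 1); rewrite ltrDl ltr01 => /(_ isT (Normc.normc (Cval f y))).
by move=> h; apply: le_trans (ler_norm _) (h _); exists y.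
Qed.

Lemma normc_ge0 (z : R[i]) : 0 <= Normc.normc z.
Proof. by rewrite -ler0c -normcE normr_ge0. Qed.

Lemma Csupnorm_le f (B : R) : 0 <= B ->
  (forall x, Normc.normc (Cval f x) <= B) -> Csupnorm f <= B.
Proof.
move=> B0 fB; rewrite /Csupnorm.
have [->|/set0P ne] := eqVneq (range (fun x => Normc.normc (Cval f x))) set0.
  by rewrite sup0.
by apply: ge_sup => // _ [x _ <-].
Qed.

Lemma Csupnorm_ge0 f : 0 <= Csupnorm f.
Proof.
have [M0|/set0P[x _]] := eqVneq [set: M] set0; last first.
  exact: le_trans (normc_ge0 _) (le_Csupnorm f x).
by rewrite /Csupnorm M0 image_set0 sup0.
Qed.

Definition Cnorm f : R[i] := (Csupnorm f)%:C.

Lemma le_Cnorm f x : `|Cval f x| <= Cnorm f.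
Proof. by rewrite normcE lecR le_Csupnorm. Qed.

Lemma Cnorm_le f (b : R[i]) : 0 <= b ->
  (forall x, `|Cval f x| <= b) -> Cnorm f <= b.
Proof.
move: b => [b c]; rewrite lecE /= => /andP[/eqP -> b0] fb.
suff : (Csupnorm f)%:C <= b%:C by [].
by rewrite lecR; apply: Csupnorm_le => // x; rewrite -lecR -normcE.
Qed.

Lemma Cnorm_ge0 f : 0 <= Cnorm f.
Proof. by rewrite ler0c Csupnorm_ge0. Qed.

Fact Cnorm_triangle f g : Cnorm (f + g) <= Cnorm f + Cnorm g.
Proof.
apply: Cnorm_le => [|x]; first by rewrite addr_ge0 ?Cnorm_ge0.
by apply: le_trans (ler_normD _ _) _; rewrite lerD ?le_Cnorm.
Qed.

Fact CnormZ k f : Cnorm (k *: f) = `|k| * Cnorm f.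
Proof.
apply/le_anti/andP; split.
  apply: Cnorm_le => [|x]; first by rewrite mulr_ge0 ?Cnorm_ge0.
  by rewrite [Cval _ _]/(k * Cval f x) normrM ler_wpM2l ?le_Cnorm.
have [->|k0] := eqVneq k 0; first by rewrite normr0 mul0r Cnorm_ge0.
rewrite -ler_pdivlMl ?normr_gt0//; apply: Cnorm_le => [|x].
  by rewrite mulr_ge0 ?invr_ge0 ?Cnorm_ge0.
rewrite ler_pdivlMl ?normr_gt0// -normrM.
exact: (le_Cnorm (k *: f) x).
Qed.

Fact Cnorm0_eq0 f : Cnorm f = 0 -> f = 0.
Proof.
move=> f0; apply: CvalP => x; apply/eqP.
by rewrite -normr_le0 -f0 le_Cnorm.
Qed.

HB.instance Definition _ :=
  Lmodule_isNormed.Build R[i] C Cnorm_triangle CnormZ Cnorm0_eq0.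

Fact C_complete (F : set_system C) : ProperFilter F -> cauchy F -> cvg F.
Proof.
move=> FF /cauchy_ballP cF.
have cFd (e : R[i]) : 0 < e ->
    \forall f & g \near F, forall x, `|Cval f x - Cval g x| < e.
  move=> e0; have := cF e e0; rewrite !near_simpl; apply: filterS => -[f g].
  rewrite -ball_normE /= => fg x; apply: le_lt_trans fg.
  exact: (le_Cnorm (f - g) x).
have cFx x : cvg (Cval f x @[f --> F]).
  apply: cauchy_cvg; apply/(@cauchy_ballP R[i]) => e e0.
  have [[P Q] [/= FP FQ] PQ] := cFd e e0.
  exists (Cval^~ x @` P, Cval^~ x @` Q).
    by split; [apply: filterS FP | apply: filterS FQ] => f Pf /=; exists f.
  move=> [_ _] [/= [f Pf <-] [g Qg <-]]; rewrite -ball_normE.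
  exact: (PQ (f, g) (conj Pf Qg) x).
pose G x := lim (Cval f x @[f --> F]).
have unif (e : R[i]) : 0 < e ->
    \forall f \near F, forall x, `|G x - Cval f x| < e.
  move=> e0; have e20 : 0 < e / 2 by rewrite divr_gt0.
  near=> f => x; near F => g.
  have fg : forall y, `|Cval f y - Cval g y| < e / 2.
    by near: g; near: f; apply: nearP_dep; exact: cFd.
  rewrite [e]splitr -(subrKA (Cval g x)).
  apply: le_lt_trans (ler_normD _ _) _; apply: ltrD.
    by near: g; have /cvgrPdist_lt/(_ _ e20) := cFx x.
  by rewrite distrC.
have cG : continuous G.
  move=> x; apply/cvgrPdist_lt => e e0.
  have e30 : 0 < e / 2 / 2 by rewrite !divr_gt0.
  near F => f.
  have fG : forall y, `|G y - Cval f y| < e / 2 / 2 by near: f; exact: unif.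
  have e20 : 0 < e / 2 by rewrite divr_gt0.
  near=> y.
  have fxy : `|Cval f x - Cval f y| < e / 2.
    by near: y; have /cvgrPdist_lt/(_ _ e20) := @Cval_continuous f x.
  have -> : G x - G y =
      (G x - Cval f x) + ((Cval f x - Cval f y) + (Cval f y - G y)).
    by rewrite !subrKA.
  have -> : e = e / 2 / 2 + (e / 2 + e / 2 / 2) by rewrite addrCA -!splitr.
  apply: le_lt_trans (ler_normD _ _) _; apply: ltrD => //.
  apply: le_lt_trans (ler_normD _ _) _; apply: ltrD => //.
  by rewrite distrC.
apply/cvg_ex; exists (mkC cG); apply/cvgrPdist_le => e e0.
near=> f; apply: Cnorm_le; first exact: ltW.
by move=> x; apply: ltW; move: x; near: f; exact: unif.
Unshelve. all: by end_near. Qed.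

HB.instance Definition _ := Uniform_isComplete.Build C C_complete.

Fact CnormM f g : `|Cmul f g| <= `|f| * `|g|.
Proof.
apply: Cnorm_le => [|x]; first by rewrite mulr_ge0.
by rewrite [Cval _ _]/(Cval f x * Cval g x) normrM ler_pM// le_Cnorm.
Qed.

Fact Cnorm_star f : `|Cmul (Cstar f) f| = `|f| ^+ 2.
Proof.
have valE x : `|Cval (Cmul (Cstar f) f) x| = `|Cval f x| ^+ 2.
  by rewrite [Cval _ _]/((Cval f x)^* * Cval f x)%R normrM norm_conjC.
apply/le_anti/andP; split.
  apply: Cnorm_le => [|x]; first by rewrite exprn_ge0.
  by rewrite valE ler_pXn2r ?nnegrE// le_Cnorm.
have s0 : 0 <= Csupnorm (Cmul (Cstar f) f) by exact: Csupnorm_ge0.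
set s := Csupnorm _ in s0.
have sE : `|Cmul (Cstar f) f| = (Num.sqrt s)%:C ^+ 2.
  by rewrite -rmorphXn /= sqr_sqrtr.
rewrite sE ler_pXn2r ?nnegrE// ?ler0c ?sqrtr_ge0//.
apply: Cnorm_le => [|x]; first by rewrite ler0c sqrtr_ge0.
have : `|Cval f x| ^+ 2 <= (Num.sqrt s)%:C ^+ 2 by rewrite -valE -sE le_Cnorm.
by rewrite ler_pXn2r ?nnegrE// ler0c sqrtr_ge0.
Qed.

Fact CmulA : associative Cmul.
Proof. by move=> f g h; apply: CvalP => x; exact: mulrA. Qed.
Fact CmulC : commutative Cmul.
Proof. by move=> f g; apply: CvalP => x; exact: mulrC. Qed.
Fact Cmul1l : left_id (Cconst 1) Cmul.
Proof. by move=> f; apply: CvalP => x; exact: mul1r. Qed.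
Fact Cmul1r : right_id (Cconst 1) Cmul.
Proof. by move=> f; apply: CvalP => x; exact: mulr1. Qed.
Fact CmulDl : left_distributive Cmul +%R.
Proof. by move=> f g h; apply: CvalP => x; exact: mulrDl. Qed.
Fact CmulDr : right_distributive Cmul +%R.
Proof. by move=> f g h; apply: CvalP => x; exact: mulrDr. Qed.
Fact CscaleAl k f g : k *: Cmul f g = Cmul (k *: f) g.
Proof. exact: CmulA. Qed.
Fact CscaleAr k f g : k *: Cmul f g = Cmul f (k *: g).
Proof. by apply: CvalP => x; exact: mulrCA. Qed.
Fact CstarK : involutive Cstar.
Proof. by move=> f; apply: CvalP => x; exact: conjCK. Qed.
Fact CstarD : {morph Cstar : f g / f + g}.
Proof. by move=> f g; apply: CvalP => x; exact: rmorphD. Qed.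
Fact CstarZ k f : Cstar (k *: f) = (k^*)%R *: Cstar f.
Proof. by apply: CvalP => x; exact: rmorphM. Qed.
Fact CstarM f g : Cstar (Cmul f g) = Cmul (Cstar g) (Cstar f).
Proof. by rewrite CmulC; apply: CvalP => x; exact: rmorphM. Qed.

Definition C_cstar : cstarAlgType R :=
  @CStarAlgebra R C (Cconst 1) Cmul Cstar CmulA Cmul1l Cmul1r CmulDl CmulDr
    CscaleAl CscaleAr CnormM CstarK CstarD CstarZ CstarM Cnorm_star.
End algebra.
End continuous_functions.

Section elements.
Context {R : realType} {A : cstarAlgType R}.
Implicit Types (a b : A) (I J : set A).

Definition selfadjoint : set A := [set a | star a = a].

Definition invertible a := exists b, a * b = 1 /\ b * a = 1.
Definition spectrum a : set R[i] := [set z : R[i] | ~ invertible (z *: (1 : A) - a)].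
(* In R[i], 0 <= z means that z is a nonnegative real number. *)
Definition positive a := star a = a /\ (forall z, spectrum a z -> 0 <= z).

(* The square root of a positive element is its unique positive square root;
   the value 0 is used if there is none. *)
Definition csqrt a : A := xget 0 [set b | positive b /\ b * b = a].
Definition cabs a : A := csqrt (star a * a).

Definition cmeet a b : A :=
  (2^-1 : R[i]) *: (a + b) - (2^-1 : R[i]) *: cabs (a - b).
Definition cjoin a b : A :=
  (2^-1 : R[i]) *: (a + b) + (2^-1 : R[i]) *: cabs (a - b).

Definition complex_span (S : set A) : set A :=
  [set a | exists n (k : 'I_n -> R[i]) (v : 'I_n -> A),
     (forall i, S (v i)) /\ a = \sum_(i < n) k i *: v i].

Record pre_isocone J : Prop := PreIsocone {
  isocone_selfadjoint : J `<=` selfadjoint;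
  isocone_closed : closed J;
  isoconeD : forall a b, J a -> J b -> J (a + b);
  isoconeZ : forall (r : R) a, 0 <= r -> J a -> J (r%:C *: a);
  isocone_meet : forall a b, J a -> J b -> J (cmeet a b);
  isocone_join : forall a b, J a -> J b -> J (cjoin a b);
  isocone_const : forall r : R, J (r%:C *: (1 : A))
}.

Definition isocone I := pre_isocone I /\ dense (complex_span I).

Definition character (m : A -> R[i]) :=
  [/\ scalar m, GRing.monoid_morphism m & forall a, m (star a) = (m a)^*%R].

Lemma normM_cstar a b : `|a * b| <= `|a| * `|b|.
Proof. exact: cstar_normM. Qed.

Lemma geometric_fixpoint a : `|a| < 1 -> exists s, s = a + a * s.
Proof.
move=> a1; pose u : A ^nat := fun n => a ^+ n.+1.
have [r ar] : exists r : R, `|a| = r%:C.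
  by have /complex_realP[r ->] : `|a| \is Num.real by []; exists r.
have r0 : 0 <= r by rewrite -ler0c -ar.
have r1 : `|r| < 1 by rewrite ger0_norm// -ltcR -ar.
have ua n : `|u n| <= (r ^+ n.+1)%:C.
  rewrite /u; elim: n => [|n ih]; first by rewrite !expr1 ar.
  rewrite exprS [r ^+ _]exprS rmorphM /= -ar.
  by apply: le_trans (normM_cstar _ _) _; rewrite ler_wpM2l.
have cu : cvgn (series u).
  apply: cauchy_cvg; apply/cauchy_seriesP => e e0.
  have [e' ee'] : exists e' : R, e = e'%:C.
    have /complex_realP[e' ->] := gtr0_real e0; by exists e'.
  have e'0 : 0 < e' by rewrite -ltcR -ee'.
  have /cvg_cauchy/cauchy_seriesP/(_ _ e'0) := @is_cvg_geometric_series R r r r1.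
  apply: filterS => -[m n] /= h; rewrite ee'.
  apply: le_lt_trans (ler_norm_sum _ _ _) _.
  move: h; rewrite -ltcR; apply: le_lt_trans.
  apply: (@le_trans _ _ (\sum_(m <= k < n) (r ^+ k.+1)%:C)).
    exact: ler_sum.
  rewrite -rmorph_sum lecR; apply: le_trans (ler_norm _).
  by apply: ler_sum => k _; rewrite /geometric /= exprS.
exists (limn (series u)).
have h1 : series u n @[n --> \oo] --> a + a * limn (series u).
  rewrite -(cvg_shiftS (series u)).
  have -> : (fun n => series u n.+1) = (fun n => a + a * series u n).
    apply/funext => n; rewrite /series /= big_nat_recl// /u expr1; congr (_ + _).
    by rewrite mulr_sumr; apply: eq_bigr => k _; rewrite exprS.
  apply: cvgD; first exact: cvg_cst.
  apply/cvgrPdist_lt => e e0; near=> n.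
  rewrite -mulrBr; apply: le_lt_trans (normM_cstar _ _) _.
  apply: (@le_lt_trans _ _ `|limn (series u) - series u n|).
    by rewrite ler_piMl// ltW.
  by near: n; have /cvgrPdist_lt/(_ _ e0) := cu.
by apply: (cvg_unique _ cu h1); exact: norm_hausdorff.
Unshelve. all: by end_near. Qed.

Lemma character_le m a : character m -> `|m a| <= `|a|.
Proof.
move=> [ml [m1 mM] _].
have m0 : m 0 = 0.
  have := ml (-1) 0 0; rewrite scaler0 addr0 mulN1r addNr; exact.
have mZ k b : m (k *: b) = k * m b by have := ml k b 0; rewrite !addr0 m0 addr0.
have mD b c : m (b + c) = m b + m c by have := ml 1 b c; rewrite scale1r mul1r.
rewrite real_leNgt ?normr_real//; apply/negP => ma.
have ma0 : 0 < `|m a| by exact: le_lt_trans ma.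
have [|s /(congr1 m)] := @geometric_fixpoint ((m a)^-1 *: a).
  by rewrite normrZ normfV mulrC ltr_pdivrMr// mul1r.
rewrite mD mM mZ mulVf -?normr_gt0// mul1r => /eqP.
by rewrite -subr_eq subrr eq_sym oner_eq0.
Qed.
End elements.

Arguments C_cstar R {M} cM.

Definition star_morphism (R : realType) (A B : cstarAlgType R) (rho : A -> B) :=
  [/\ linear rho, GRing.monoid_morphism rho
    & forall a, rho (star a) = star (rho a)].

Definition istar_morphism (R : realType) (A B : cstarAlgType R)
    (I : set A) (I' : set B) (rho : A -> B) :=
  [/\ star_morphism rho, rho @` I `<=` I'
    & forall J, pre_isocone J -> J `<=` I -> closed (rho @` J)].

Record istarAlgType (R : realType) := IstarAlgebra {
  istar_alg :> cstarAlgType R;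
  istar_cone : set istar_alg;
  istar_isocone : isocone istar_cone
}.
Arguments istar_cone {R} X _ : rename.

Record abIstarAlgType (R : realType) := AbIstarAlgebra {
  ab_istar :> istarAlgType R;
  ab_mulC : commutative (fun a b : ab_istar => a * b)
}.

(* The display of an order is only a tag that drives notations. *)
Definition ord_display := Order.Disp tt tt.
Notation ordTopType := (POrderedTopological.type ord_display).

Definition isotone (M N : ordTopType) (f : M -> N) :=
  forall x y : M, (x <= y)%O -> (f x <= f y)%O.

Definition real_isotone (R : realType) (M : ordTopType) : set (M -> R) :=
  [set f | continuous f /\ forall x y : M, (x <= y)%O -> f x <= f y].

Arguments real_isotone R M _ : clear implicits.

Definition toposet (R : realType) (M : ordTopType) :=
  forall x y : M, (x <= y)%O <-> (forall f, real_isotone R M f -> f x <= f y).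

Record compactToposet (R : realType) := CompactToposet {
  kt_space :> ordTopType;
  kt_compact : compact [set: kt_space];
  kt_toposet : toposet R kt_space
}.
Arguments kt_compact {R} M : rename.

Section isotone_functions.
Context {R : realType}.

Definition isotone_cone (M : compactToposet R) :
    set (C_cstar R (kt_compact M)) :=
  [set c | exists2 f, real_isotone R M f & forall x, Cval c x = (f x)%:C].

Arguments isotone_cone M _ : clear implicits.

Definition Cpullback (M N : compactToposet R) (f : M -> N)
    (cf : continuous f) (g : C_cstar R (kt_compact N)) :
    C_cstar R (kt_compact M) :=
  @mkC R M (kt_compact M) _
    (fun x => continuous_comp (cf x) (@Cval_continuous R N (kt_compact N) g (f x))).
End isotone_functions.
Arguments isotone_cone {R} M _.

Section character_space.
Context {R : realType} (X : istarAlgType R).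

(* The weak-* topology is the topology of pointwise convergence, i.e. the one
   induced by the product topology on functions X -> R[i]. Characters take
   real values on the cone, where the order of R[i] is that of R. *)
Definition char_space : Type := {m : X -> R[i] | character m}.
Definition char_fun (m : char_space) : {ptws X -> R[i]} := sval m.

HB.instance Definition _ := gen_eqMixin char_space.
HB.instance Definition _ := gen_choiceMixin char_space.
HB.instance Definition _ :=
  Topological.copy char_space (initial_topology char_fun).

Definition char_le (m n : char_space) : bool :=
  `[< forall c, istar_cone X c -> sval m c <= sval n c >].

Lemma val_inj_char (m n : char_space) : sval m = sval n -> m = n.
Proof. by case: m n => [m Pm] [n Pn] /= mn; exact: eq_exist. Qed.

Fact char_le_refl : reflexive char_le.
Proof. by move=> m; apply/asboolP. Qed.

Fact char_le_trans : transitive char_le.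
Proof.
move=> n m p /asboolP mn /asboolP np; apply/asboolP => c Ic.
exact: le_trans (mn c Ic) (np c Ic).
Qed.

Fact char_le_anti : antisymmetric char_le.
Proof.
move=> m n /andP[/asboolP mn /asboolP nm].
have mnI c : istar_cone X c -> sval m c = sval n c.
  by move=> Ic; apply/le_anti; rewrite mn ?nm.
apply: val_inj_char; apply/funext => a.
have [ml _ _] := svalP m.
have mle c : `|sval m c| <= `|c| := @character_le R X _ c (svalP m).
have [nl _ _] := svalP n.
have nle c : `|sval n c| <= `|c| := @character_le R X _ c (svalP n).
have mnS b : complex_span (istar_cone X) b -> sval m b = sval n b.
  move=> [k [z [v [vI ->]]]]; elim: k z v vI => [|k ih] z v vI.
    rewrite !big_ord0.
    have := ml (-1) 0 0; have := nl (-1) 0 0.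
    by rewrite !scaler0 !addr0 !mulN1r !addNr => -> ->.
  by rewrite !big_ord_recl ml nl (mnI _ (vI _)) ih.
have [_ dI] := istar_isocone X.
apply/eqP; rewrite -subr_eq0 -normr_le0; apply/ler_addgt0Pl => e e0.
have e20 : 0 < e / 2 by rewrite divr_gt0.
have [|b [ab bS]] := dI _ _ (@ball_open _ X a (e / 2)).
  by exists a; exact: ballxx.
move: ab; rewrite -ball_normE /= => ab.
have mB c d : sval m (c - d) = sval m c - sval m d.
  by rewrite addrC -scaleN1r ml mulN1r addrC.
have nB c d : sval n (c - d) = sval n c - sval n d.
  by rewrite addrC -scaleN1r nl mulN1r addrC.
rewrite addr0 [e]splitr -(subrKA (sval m b)) {2}(mnS b bS).
apply: le_trans (ler_normD _ _) _.
rewrite -mB -nB; apply: lerD.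
  exact: le_trans (mle _) (ltW ab).
by apply: le_trans (nle _) _; rewrite distrC ltW.
Qed.

HB.instance Definition _ := Order.Le_isPOrder.Build ord_display char_space
  char_le_refl char_le_anti char_le_trans.
End character_space.

Section character_pullback.
Context {R : realType} (X Y : istarAlgType R) (rho : X -> Y)
  (rhoM : istar_morphism (istar_cone X) (istar_cone Y) rho).

Fact char_pullback_subproof (m : char_space Y) : character (sval m \o rho).
Proof.
case: (svalP m) rhoM => ml [m1 mM] ms [[rl [r1 rM] rs] _ _]; split => [k a b||a] /=.
- by rewrite rl ml.
- by split=> [|a b] /=; rewrite ?r1 ?m1// rM mM.
- by rewrite rs ms.
Qed.

Definition char_pullback (m : char_space Y) : char_space X :=
  exist _ (sval m \o rho) (char_pullback_subproof m).

Fact char_pullback_continuous : continuous char_pullback.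
Proof.
apply: continuous_comp_initial => m.
apply/(@pointwise_cvgP X R[i] _ _ (fmap_filter _ (nbhs_filter m))) => c.
by have /(@pointwise_cvgP Y R[i] _ _ (fmap_filter _ (nbhs_filter m)))/(_ (rho c)) :=
  @initial_continuous _ _ (@char_fun R Y) m.
Qed.

Fact char_pullback_isotone : isotone char_pullback.
Proof.
move=> m n /asboolP mn; apply/asboolP => c Ic.
by apply: mn; case: rhoM => _ + _; apply; exists c.
Qed.
End character_pullback.

Record category := Category {
  obj :> Type;
  hom : obj -> obj -> Type;
  idm : forall X, hom X X;
  comp : forall X Y Z, hom Y Z -> hom X Y -> hom X Z;
  comp_idl : forall X Y (f : hom X Y), comp (idm Y) f = f;
  comp_idr : forall X Y (f : hom X Y), comp f (idm X) = f;
  compA : forall W X Y Z (f : hom W X) (g : hom X Y) (h : hom Y Z),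
    comp h (comp g f) = comp (comp h g) f
}.
Arguments hom {c}.
Arguments idm {c}.
Arguments comp {c X Y Z}.

Record functor (C D : category) := Functor {
  fun_obj :> C -> D;
  fun_map : forall X Y, hom X Y -> hom (fun_obj X) (fun_obj Y);
  fun_id : forall X, fun_map (idm X) = idm (fun_obj X);
  fun_comp : forall X Y Z (f : hom X Y) (g : hom Y Z),
    fun_map (comp g f) = comp (fun_map g) (fun_map f)
}.

Record cofunctor (C D : category) := Cofunctor {
  cofun_obj :> C -> D;
  cofun_map : forall X Y, hom X Y -> hom (cofun_obj Y) (cofun_obj X);
  cofun_id : forall X, cofun_map (idm X) = idm (cofun_obj X);
  cofun_comp : forall X Y Z (f : hom X Y) (g : hom Y Z),
    cofun_map (comp g f) = comp (cofun_map f) (cofun_map g)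
}.

Definition id_functor (C : category) : functor C C :=
  @Functor C C id (fun _ _ f => f) (fun _ => erefl) (fun _ _ _ _ _ => erefl).

Section cofunctor_composition.
Context {C D E : category} (G : cofunctor D E) (F : cofunctor C D).

Fact comp_cofun_id X : cofun_map G (cofun_map F (idm X)) = idm (G (F X)).
Proof. by rewrite !cofun_id. Qed.

Fact comp_cofun_comp X Y Z (f : hom X Y) (g : hom Y Z) :
  cofun_map G (cofun_map F (comp g f)) =
  comp (cofun_map G (cofun_map F g)) (cofun_map G (cofun_map F f)).
Proof. by rewrite !cofun_comp. Qed.

Definition comp_cofunctor : functor C E :=
  @Functor C E (fun X => G (F X)) (fun _ _ f => cofun_map G (cofun_map F f))
    comp_cofun_id comp_cofun_comp.
End cofunctor_composition.

Definition naturally_isomorphic (C D : category) (F G : functor C D) :=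
  exists (u : forall X, hom (F X) (G X)) (v : forall X, hom (G X) (F X)),
  [/\ forall X, comp (v X) (u X) = idm (F X),
      forall X, comp (u X) (v X) = idm (G X)
    & forall X Y (f : hom X Y), comp (u Y) (fun_map F f) = comp (fun_map G f) (u X)].

Definition dual_equivalence (C D : category)
    (F : cofunctor C D) (G : cofunctor D C) :=
  naturally_isomorphic (comp_cofunctor G F) (id_functor C) /\
  naturally_isomorphic (comp_cofunctor F G) (id_functor D).

Section KT.
Context (R : realType).

Definition KT_hom (M N : compactToposet R) : Type :=
  {f : M -> N | continuous f /\ isotone f}.

Lemma KT_homP M N (f g : KT_hom M N) : sval f =1 sval g -> f = g.
Proof.
by case: f g => [f Pf] [g Pg] /= /funext fg; exact: eq_exist.
Qed.

Fact KT_id_subproof (M : compactToposet R) :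
  continuous (@id M) /\ isotone (@id M).
Proof. by split=> // x; exact: cvg_id. Qed.

Fact KT_comp_subproof (M N P : compactToposet R) (g : KT_hom N P)
  (f : KT_hom M N) : continuous (sval g \o sval f) /\ isotone (sval g \o sval f).
Proof.
case: g f => [g [cg ig]] [f [cf hf]] /=; split=> [x|x y xy].
  exact: continuous_comp (cf x) (cg (f x)).
by apply: ig; exact: hf.
Qed.

Definition KT : category.
refine (@Category (compactToposet R) KT_hom
  (fun M => exist _ id (KT_id_subproof M))
  (fun M N P g f => exist _ (sval g \o sval f) (KT_comp_subproof g f)) _ _ _).
- by move=> M N f; exact: KT_homP.
- by move=> M N f; exact: KT_homP.
- by move=> M N P Q f g h; exact: KT_homP.
Defined.
End KT.

(* The facts that make the constructions meaningful: I*-morphisms compose, and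
   the two assignments take objects to objects and morphisms to morphisms (for
   pullbacks of characters this is proved above). They are propositions; the
   categories and functors below are built from a proof of them. *)
Record well_defined (R : realType) : Prop := WellDefined {
  istar_morphism_comp : forall (X Y Z : abIstarAlgType R) (f : X -> Y) (g : Y -> Z),
    istar_morphism (istar_cone X) (istar_cone Y) f ->
    istar_morphism (istar_cone Y) (istar_cone Z) g ->
    istar_morphism (istar_cone X) (istar_cone Z) (g \o f);
  isotone_isocone : forall M : compactToposet R, isocone (isotone_cone M);
  Cpullback_istar : forall (M N : compactToposet R) (f : M -> N)
    (cf : continuous f), isotone f ->
    istar_morphism (isotone_cone N) (isotone_cone M) (Cpullback cf);
  char_space_compact : forall X : abIstarAlgType R, compact [set: char_space X];
  char_space_toposet : forall X : abIstarAlgType R, toposet R (char_space X)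
}.

Section functors.
Context {R : realType} (wd : well_defined R).

Definition abIC_hom (X Y : abIstarAlgType R) : Type :=
  {rho : X -> Y | istar_morphism (istar_cone X) (istar_cone Y) rho}.

Lemma abIC_homP X Y (f g : abIC_hom X Y) : sval f =1 sval g -> f = g.
Proof.
by case: f g => [f Pf] [g Pg] /= /funext fg; exact: eq_exist.
Qed.

Fact abIC_id_subproof (X : abIstarAlgType R) :
  istar_morphism (istar_cone X) (istar_cone X) id.
Proof.
split; first by split.
  by move=> _ [c Ic <-].
by move=> J [_ cJ _ _ _ _ _] _; rewrite image_id.
Qed.

Definition abIC : category.
refine (@Category (abIstarAlgType R) abIC_hom
  (fun X => exist _ id (abIC_id_subproof X))
  (fun X Y Z g f => exist _ (sval g \o sval f)
     (istar_morphism_comp wd (svalP f) (svalP g))) _ _ _).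
- by move=> X Y f; exact: abIC_homP.
- by move=> X Y f; exact: abIC_homP.
- by move=> W X Y Z f g h; exact: abIC_homP.
Defined.

Definition isotone_algebra (M : compactToposet R) : abIstarAlgType R :=
  @AbIstarAlgebra R (IstarAlgebra (isotone_isocone wd M)) (@CmulC R M (kt_compact M)).

Definition isotone_map (M N : compactToposet R) (f : KT_hom M N) :
    abIC_hom (isotone_algebra N) (isotone_algebra M) :=
  exist _ (Cpullback (svalP f).1) (Cpullback_istar wd (svalP f).1 (svalP f).2).

Definition isotone_functor : cofunctor (KT R) abIC.
refine (@Cofunctor (KT R) abIC isotone_algebra isotone_map _ _).
- by move=> M; apply: abIC_homP => g; exact: CvalP.
- by move=> M N P f g; apply: abIC_homP => h; exact: CvalP.
Defined.

Definition character_toposet (X : abIstarAlgType R) : compactToposet R :=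
  @CompactToposet R (char_space X) (@char_space_compact R wd X)
    (@char_space_toposet R wd X).

Definition character_map (X Y : abIstarAlgType R) (f : abIC_hom X Y) :
    KT_hom (character_toposet Y) (character_toposet X) :=
  exist _ (char_pullback (svalP f))
    (conj (@char_pullback_continuous R X Y _ (svalP f))
          (@char_pullback_isotone R X Y _ (svalP f))).

Definition character_functor : cofunctor abIC (KT R).
refine (@Cofunctor abIC (KT R) character_toposet character_map _ _).
- by move=> X; apply: KT_homP => m; exact: val_inj_char.
- by move=> X Y Z f g; apply: KT_homP => m; exact: val_inj_char.
Defined.
End functors.

(* Main.v *)
From HB Require Import structures.
From mathcomp Require Import all_boot all_order all_algebra complex.
From mathcomp Require Import all_classical reals topology normedtype sequences.
From mathcomp Require Import ring lra.
Require Import Defs.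
Set Implicit Arguments.
Unset Strict Implicit.
Unset Printing Implicit Defensive.
Import Order.TTheory GRing.Theory Num.Theory.
Import numFieldNormedType.Exports.
Local Open Scope classical_set_scope.
Local Open Scope ring_scope.
Local Open Scope complex_scope.

(** A compact toposet is recovered from its continuous isotone functions, and an
    abelian I*-algebra from its characters. Two facts carry everything: a
    commutative C*-algebra has enough characters, and an isocone contains every
    continuous function that is isotone for the order it defines.

    Characters. The route is real-algebraic and uses neither complex analysis
    nor quotient algebras. In a commutative C*-algebra, 1 - x has a
    self-adjoint square root when x is self-adjoint with |x| < 1
    ([sqrt_one_minus], a fixed point), so t - h is a square as soon as |h| < t:
    in a nonzero algebra the sums of squares are an archimedean preordering of
    the self-adjoint part. Zorn gives maximal preorderings; such a Q is a total
    order up to infinitesimals, and taking standard parts modulo Q is a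
    character. Starting from the sums of squares with -a adjoined, this yields
    [character_le0_or_positive]: either some character is nonpositive at a, or
    a q = 1 + p with p, q sums of squares. In the second case a is itself a sum
    of squares ([sos_of_mul_eq_add1]). Applied to t^2 + e - h^2 this bounds |h|
    by the values of the characters ([norm_le_char]), because |x^2| is at most
    |x^2 + y^2|; applied to a^* a it inverts elements on which no character
    vanishes ([invertible_of_char]). Hence positive elements have positive
    square roots and every character sends |a|, a meet and a join to the
    absolute value, minimum and maximum of the values ([char_abs]). All star
    morphisms therefore preserve meets and joins, and the image of a
    pre-isocone, once closed, is a pre-isocone; so I*-morphisms compose.

    Isocones. The lattice form of the Stone-Weierstrass theorem
    ([lattice_approximation]) says that a lattice of continuous functions on a
    compact space approximates every continuous function that it interpolates
    at each pair of points. Differences of isotone functions interpolate all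
    continuous functions, so I(M) generates C(M) ([isotone_cone_isocone]). An
    isocone I interpolates f at two points as soon as f is isotone for the
    order of I, so the Gelfand transform, which is isometric, maps I onto the
    isotone functions ([gelfand_cone_eq]) and X onto all continuous functions
    ([gelfand_surj]).

    Remaining ingredients: restriction to the image of M along f : M -> N has
    closed image on pre-isocones, since an approximating sequence can be
    clipped to converge on all of N ([Cpullback_closed_image]); the character
    space is closed in a product of compact sets ([char_space_is_compact]); and
    every character of C(M) is an evaluation ([character_evaluation]). *)

(** * Complex numbers as values *)

Section complex_numbers.
Context {R : realType}.
Implicit Types (r : R) (z : R[i]).

Lemma complex_gt0_real z : 0 < z -> exists2 r : R, 0 < r & z = r%:C.
Proof.
move=> z0; have /complex_realP[r zr] := gtr0_real z0.
by exists r => //; rewrite -ltcR -zr.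
Qed.

(** Norms are elements of R[i]; this gives the real number behind one. *)
Lemma norm_real (W : normedZmodType R[i]) (a : W) :
  exists2 r : R, 0 <= r & `|a| = r%:C.
Proof.
have /complex_realP[r ar] := normr_real a.
by exists r => //; rewrite -ler0c -ar.
Qed.

Lemma norm_lt_real (W : normedZmodType R[i]) (a : W) :
  exists2 r : R, 0 <= r & `|a| < r%:C.
Proof.
have [r r0 ->] := norm_real a; exists (r + 1); first by rewrite addr_ge0.
by rewrite ltcR ltrDl.
Qed.

Lemma norm_real_complex r : `|r%:C : R[i]| = `|r|%:C.
Proof. by rewrite normc_def /= expr0n addr0 sqrtr_sqr. Qed.

Lemma norm_i : `|'i%C : R[i]| = 1.
Proof. by rewrite normc_def /= expr0n expr1n add0r sqrtr1. Qed.

Lemma half_complex : (2^-1 : R[i]) = (2^-1)%:C.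
Proof. by rewrite fmorphV rmorph_nat. Qed.

Lemma conjc_i : ('i%C : R[i])^*%R = - 'i%C.
Proof. by apply/eqP; rewrite eq_complex /= oppr0 !eqxx. Qed.

Lemma conjc_realE r : ((r%:C : R[i])^*)%R = r%:C.
Proof. by apply/eqP; rewrite eq_complex /= oppr0 !eqxx. Qed.

Lemma conjc_real z : z^*%R = z -> z = (complex.Re z)%:C.
Proof.
case: z => x y /eqP; rewrite eq_complex /= eqxx /= => /eqP yN.
by congr (_ +i* _); lra.
Qed.

Lemma abs_Im_le z : `|complex.Im z|%:C <= `|z|.
Proof.
by have := normc_ge_Re (z * 'i); rewrite ReiNIm normrN normrM norm_i mulr1.
Qed.

Lemma real_complex_continuous : continuous (fun x : R => x%:C).
Proof.
move=> x; apply/cvgrPdist_lt => _ /complex_gt0_real[e e0 ->].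
have /cvgrPdist_lt/(_ _ e0) := @cvg_id _ (nbhs x); apply: filterS => y.
by rewrite -rmorphB norm_real_complex ltcR.
Qed.

Lemma Re_continuous : continuous (@complex.Re R).
Proof.
move=> z; apply/(cvgrPdist_lt (FF := nbhs_filter z)) => e e0; near=> w.
have : `|z - w| < e%:C.
  by near: w; move/cvgrPdist_lt: (@cvg_id _ (nbhs z)); apply; rewrite ltcR.
move=> /(le_lt_trans (normc_ge_Re _)); rewrite ltcR.
by case: (z) (w) => [? ?] [? ?].
Unshelve. all: by end_near. Qed.

Lemma Im_continuous : continuous (@complex.Im R).
Proof.
move=> z; apply/(cvgrPdist_lt (FF := nbhs_filter z)) => e e0; near=> w.
have : `|z - w| < e%:C.
  by near: w; move/cvgrPdist_lt: (@cvg_id _ (nbhs z)); apply; rewrite ltcR.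
move=> /(le_lt_trans (abs_Im_le _)); rewrite ltcR.
by case: (z) (w) => [? ?] [? ?].
Unshelve. all: by end_near. Qed.

Lemma complex_box_compact r : exists2 B : set R[i], compact B &
  forall z, `|z| <= r%:C -> B z.
Proof.
pose g (p : R * R) : R[i] := p.1%:C + 'i%C * p.2%:C.
have cg : continuous g.
  move=> p; apply: cvgD.
    by apply: (continuous_comp (f := fst)); [exact: cvg_fst|exact: real_complex_continuous].
  apply: cvgM; first exact: cvg_cst.
  by apply: (continuous_comp (f := snd)); [exact: cvg_snd|exact: real_complex_continuous].
exists (g @` (`[- r, r] `*` `[- r, r])).
  apply: continuous_compact; first exact: continuous_subspaceT.
  by apply: compact_setX; exact: segment_compact.
move=> z zr; exists (complex.Re z, complex.Im z); last by rewrite /g /= -complexE.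
have h1 := le_trans (normc_ge_Re z) zr; have h2 := le_trans (abs_Im_le z) zr.
by move: h1 h2; rewrite !lecR !ler_norml => h1 h2; split; rewrite /= in_itv.
Qed.

End complex_numbers.

(** * Limits of geometrically convergent sequences *)

Section geometric_convergence.
Context {R : realType} {V : completeNormedModType R[i]}.
Implicit Types (u : V ^nat) (c e r : R).

Lemma geometric_cvg u c r : 0 <= r < 1 ->
  (forall n, `|u n.+1 - u n| <= (c * r ^+ n)%:C) -> cvgn u.
Proof.
move=> /andP[r0 r1] uB; pose v n := u n.+1 - u n.
have -> : u = (fun n => u 0%N + series v n).
  by apply/funext => n; rewrite /series /= telescope_sumr// addrC subrK.
apply: is_cvgD; first exact: is_cvg_cst.
apply: cauchy_cvg; apply/cauchy_seriesP => _ /complex_gt0_real[e e0 ->].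
have /cvg_cauchy/cauchy_seriesP/(_ _ e0) :=
  @is_cvg_geometric_series R c r (eq_ind_r (fun x => x < 1) r1 (ger0_norm r0)).
apply: filterS => -[m n] /= h.
apply: le_lt_trans (ler_norm_sum _ _ _) _.
move: h; rewrite -ltcR; apply: le_lt_trans.
apply: (@le_trans _ _ (\sum_(m <= k < n) (c * r ^+ k)%:C)).
  by apply: ler_sum => k _; exact: uB.
by rewrite -rmorph_sum lecR ler_norm.
Qed.

Lemma le_normc_addeps (W : normedZmodType R[i]) (a : W) (b c : R) : 0 <= c ->
  (forall e, 0 < e -> `|a| <= (b + c * e)%:C) -> `|a| <= b%:C.
Proof.
move=> c0 h; have [r r0 ar] := norm_real a.
rewrite ar lecR; apply/ler_addgt0Pr => e e0.
have c10 : 0 < c + 1 by rewrite ltr_wpDl.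
have := h (e / (c + 1)); rewrite divr_gt0// => /(_ isT).
rewrite ar lecR => /le_trans; apply; rewrite lerD2l mulrA ler_pdivrMr//.
by rewrite mulrC ler_wpM2l ?ltW// ltrDl.
Qed.

Lemma norm_le_eps0 (W : normedZmodType R[i]) (a : W) (c : R) : 0 <= c ->
  (forall e : R, 0 < e -> `|a| <= (c * e)%:C) -> a = 0.
Proof.
move=> c0 h; apply/eqP; rewrite -normr_le0 -[0]/(0%:C).
by apply: (le_normc_addeps c0) => e; rewrite add0r; exact: h.
Qed.

Lemma half_geometric_cvg u c :
  (forall n, `|u n.+1 - u n| <= (c * 2^-1 ^+ n)%:C) -> cvgn u.
Proof.
by apply: geometric_cvg; rewrite invr_ge0 ler0n invf_lt1 ?ltr1n.
Qed.

(** The two estimates needed to identify a limit: one index at which both the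
    sequence and its rate of convergence are within e. *)
Lemma limn_half_approx u e : cvgn u -> 0 < e ->
  exists n, `|limn u - u n| <= e%:C /\ 2^-1 ^+ n <= e.
Proof.
move=> cu e0; have [N _ uN] : \forall n \near \oo, `|limn u - u n| <= e%:C.
  by have /cvgrPdist_le/(_ e%:C) := cu; apply; rewrite ltcR.
have [N' _ dN] : \forall n \near \oo, `|0 - 2^-1 ^+ n| <= e.
  have h2 : `|2^-1 : R| < 1 by rewrite ger0_norm ?invr_ge0// invf_lt1 ?ltr1n.
  by have /cvgrPdist_le/(_ e) := cvg_expr h2; apply.
exists (maxn N N'); split; first by apply: uN => /=; exact: leq_maxl.
have := dN (maxn N N') (leq_maxr _ _).
by rewrite sub0r normrN ger0_norm// exprn_ge0// invr_ge0.
Qed.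

End geometric_convergence.

(** * Commutative C*-algebras *)

(** An alias of the carrier with a commutative ring structure, so that the ring
    tactic applies to identities in a commutative C*-algebra. *)
Definition commutativeAlg (R : realType) (A : cstarAlgType R)
  (AC : commutative (fun a b : A => a * b)) : Type := A.
HB.instance Definition _ (R : realType) (A : cstarAlgType R) AC :=
  GRing.PzRing.copy (@commutativeAlg R A AC) A.
HB.instance Definition _ (R : realType) (A : cstarAlgType R) AC :=
  GRing.PzRing_hasCommutativeMul.Build (@commutativeAlg R A AC) AC.

Ltac cring :=
  match goal with
  | AC : commutative _ |- @eq _ ?x ?y => change (@eq (commutativeAlg AC) x y); ring
  end.

Section cstar_basics.
Context {R : realType} {A : cstarAlgType R}.
Implicit Types (a b x y : A) (k : R[i]).

(** Scalars as elements: [sc] is a ring morphism, so scalings become products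
    and take part in ring identities. *)
Definition scalar_elt k : A := k *: (1 : A).
Local Notation sc := scalar_elt.

Lemma scale_scalar k a : k *: a = sc k * a.
Proof. by have := cstar_scaleAl k (1 : A) a; rewrite cstar_mul1l. Qed.

Lemma scalar_eltC k a : sc k * a = a * sc k.
Proof.
rewrite -scale_scalar; have := cstar_scaleAr k a (1 : A).
by rewrite cstar_mul1r.
Qed.

Fact scalar_elt_is_zmod_morphism : zmod_morphism sc.
Proof. by move=> k l; rewrite /scalar_elt scalerBl. Qed.
Fact scalar_elt_is_monoid_morphism : GRing.monoid_morphism sc.
Proof.
split=> [|k l]; first exact: scale1r.
by rewrite -scale_scalar /scalar_elt scalerA.
Qed.
HB.instance Definition _ :=
  GRing.isZmodMorphism.Build R[i] A sc scalar_elt_is_zmod_morphism.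
HB.instance Definition _ :=
  GRing.isMonoidMorphism.Build R[i] A sc scalar_elt_is_monoid_morphism.

Lemma starD a b : star (a + b) = star a + star b. Proof. exact: cstar_starD. Qed.
Lemma starM a b : star (a * b) = star b * star a. Proof. exact: cstar_starM. Qed.
Lemma starK a : star (star a) = a. Proof. exact: cstar_starK. Qed.
Lemma starZ k a : star (k *: a) = (k^*)%R *: star a.
Proof. exact: cstar_starZ. Qed.
Lemma star1 : star (1 : A) = 1.
Proof. by have := congr1 (@star R A) (mul1r (star (1 : A))); rewrite starM !starK mul1r. Qed.
Lemma starN a : star (- a) = - star a.
Proof. by rewrite -scaleN1r starZ rmorphN1 scaleN1r. Qed.
Lemma starB a b : star (a - b) = star a - star b.
Proof. by rewrite starD starN. Qed.
Lemma star_scalar k : star (sc k) = sc (k^*)%R.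
Proof. by rewrite /scalar_elt starZ star1. Qed.
Lemma star_real (r : R) : star (sc r%:C) = sc r%:C.
Proof. by rewrite star_scalar; congr sc; exact: conjc_realE. Qed.

Lemma scalar_i_sqr : sc ('i%C : R[i]) * sc 'i%C = -1 :> A.
Proof. by rewrite -rmorphM -expr2 sqr_i rmorphN1. Qed.
Lemma star_scalar_i : star (sc 'i%C : A) = - sc 'i%C.
Proof. by rewrite star_scalar conjc_i rmorphN. Qed.

Lemma norm_starM a : `|star a * a| = `|a| ^+ 2.
Proof. exact: cstar_normE. Qed.

Lemma norm_star a : `|star a| = `|a|.
Proof.
suff h b : `|b| <= `|star b|.
  by apply/le_anti; rewrite h /= -{2}(starK a) h.
have [->|b0] := eqVneq b 0; first by rewrite normr0.
have := normM_cstar (star b) b; rewrite norm_starM expr2.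
by rewrite ler_pM2r ?normr_gt0.
Qed.

Lemma norm1_le : `|1 : A| <= 1.
Proof.
have := norm_starM 1; rewrite star1 mul1r expr2.
have [->|n0] := eqVneq `|1 : A| 0; first by [].
by move/(congr1 (fun z => z / `|1 : A|)); rewrite divff// mulfK// => <-.
Qed.

Lemma norm_scalar_le k : `|sc k| <= `|k|.
Proof.
by rewrite /scalar_elt normrZ ler_piMr ?norm1_le.
Qed.

Lemma normc_real (r : R) : 0 <= r -> `|r%:C| = r%:C.
Proof. by move=> r0; rewrite ger0_norm ?ler0c. Qed.

Lemma norm_real_scalar_le (r : R) : 0 <= r -> `|sc r%:C| <= r%:C.
Proof. by move=> r0; rewrite -{2}(normc_real r0) norm_scalar_le. Qed.

Lemma norm_sqr a : star a = a -> `|a * a| = `|a| ^+ 2.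
Proof. by move=> sa; rewrite -{1}sa norm_starM. Qed.

End cstar_basics.
Notation sc := scalar_elt.

Section square_roots.
Context {R : realType} {A : cstarAlgType R}.
Hypothesis AC : commutative (fun a b : A => a * b).
Implicit Types (a b h x y : A) (r t : R).

(** The order content of the C*-identity: x^2 + y^2 is z^* z for z = x + i y, and
    x is the mean of z and z^*, so |x| is at most |z|. *)
Lemma norm_sqr_le x y : star x = x -> star y = y -> `|x * x| <= `|x * x + y * y|.
Proof.
move=> sx sy; pose z : A := x + sc 'i%C * y.
have sz : star z = x - sc 'i%C * y.
  by rewrite /z starD starM sx sy star_scalar_i mulrN -scalar_eltC.
have -> : x * x + y * y = star z * z.
  rewrite sz /z.
  transitivity (x * x - (sc ('i%C : R[i]) * sc 'i%C) * (y * y)); last by cring.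
  by rewrite scalar_i_sqr mulN1r opprK.
rewrite norm_starM norm_sqr// ler_pXn2r ?nnegrE//.
have -> : x = sc (2^-1) * (z + star z).
  rewrite sz /z.
  transitivity (sc (2^-1 * 2 : R[i]) * x); first by rewrite mulVf ?pnatr_eq0// rmorph1 mul1r.
  by rewrite rmorphM rmorph_nat; cring.
rewrite -scale_scalar normrZ.
apply: (@le_trans _ _ (`|2^-1 : R[i]| * (`|z| + `|z|))).
  by rewrite ler_wpM2l// (le_trans (ler_normD _ _))// norm_star.
by rewrite -mulr2n -[`|z| *+ 2]mulr_natl mulrA ger0_norm ?invr_ge0 ?ler0n// mulVf ?pnatr_eq0// mul1r.
Qed.

(** The square root is 1 - u with u = (x + u^2) / 2; this map is r-lipschitz on
    the ball of radius r < 1, so its iterates from 0 converge geometrically. *)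
Lemma sqrt_one_minus x (r : R) : star x = x -> 0 <= r < 1 -> `|x| <= r%:C ->
  exists u : A, [/\ star u = u, `|u| <= r%:C & (1 - u) * (1 - u) = 1 - x].
Proof.
move=> sx /andP[r0 r1] xr.
pose F (v : A) : A := sc (2^-1%:C) * (x + v * v).
pose u n := iter n F (0 : A).
have n2 : `|(2^-1)%:C : R[i]| = (2^-1)%:C by rewrite normc_real ?invr_ge0.
have us n : star (u n) = u n.
  elim: n => [|n ih]; first by rewrite /u /= -[0](subrr 1) starB star1.
  by rewrite /u /= -/(u n) /F starM star_real -scalar_eltC starD starM ih sx.
have un n : `|u n| <= r%:C.
  elim: n => [|n ih]; first by rewrite normr0 ler0c.
  rewrite /u /= -/(u n) /F -scale_scalar normrZ n2.
  apply: (@le_trans _ _ ((2^-1)%:C * (r%:C + r%:C * r%:C))).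
    rewrite ler_wpM2l ?ler0c ?invr_ge0//.
    apply: le_trans (ler_normD _ _) _; rewrite lerD//.
    by apply: le_trans (normM_cstar _ _) _; rewrite ler_pM.
  by rewrite -rmorphM -rmorphD -rmorphM lecR; nra.
have FB v w : F v - F w = sc (2^-1%:C) * ((v + w) * (v - w)).
  by rewrite /F; cring.
have Flip v w : `|v| <= r%:C -> `|w| <= r%:C -> `|F v - F w| <= r%:C * `|v - w|.
  move=> vr wr; rewrite FB -scale_scalar normrZ n2.
  apply: (@le_trans _ _ ((2^-1)%:C * ((r%:C + r%:C) * `|v - w|))).
    rewrite ler_wpM2l ?ler0c ?invr_ge0//.
    apply: le_trans (normM_cstar _ _) _; rewrite ler_wpM2r//.
    by apply: le_trans (ler_normD _ _) _; rewrite lerD.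
  rewrite mulrA ler_wpM2r// -rmorphD -rmorphM lecR; nra.
have cu : cvgn u.
  apply: (@geometric_cvg _ _ _ 1 r); first by rewrite r0.
  elim=> [|n ih].
    rewrite {2}/u /= subr0 expr0 mulr1; apply: le_trans (un 1%N) _.
    by rewrite lecR ltW.
  rewrite exprS mulrCA rmorphM.
  apply: (@le_trans _ _ (r%:C * `|u n.+1 - u n|)).
    exact: (Flip (u n.+1) (u n) (un _) (un _)).
  by rewrite ler_wpM2l ?ler0c.
pose l := limn u.
have ul (e : R) : 0 < e -> exists n, `|l - u n| <= e%:C /\ `|l - u n.+1| <= e%:C.
  move=> e0; have /cvgrPdist_le/(_ e%:C) := cu; rewrite ltcR => /(_ e0).
  by case=> n _ h; exists n; split; apply: h => /=; exact: leqnSn || exact: leqnn.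
have lr : `|l| <= r%:C.
  apply: (@le_normc_addeps _ _ _ _ 1) => // e /ul[n [h _]].
  rewrite -(subrK (u n) l) mul1r addrC rmorphD /=.
  by rewrite (le_trans (ler_normD _ _))// lerD.
exists l; split=> //.
- apply/eqP; rewrite -subr_eq0; apply/eqP; apply: (@norm_le_eps0 _ _ _ 2) => //.
  move=> e /ul[n [h _]].
  rewrite -(subrKA (u n)) mulr_natl mulr2n rmorphD /=.
  rewrite (le_trans (ler_normD _ _))// lerD//; last by rewrite distrC.
  by rewrite -{1}(us n) -starB norm_star.
- have lF : l = F l.
    apply/eqP; rewrite -subr_eq0; apply/eqP; apply: (@norm_le_eps0 _ _ _ 2) => //.
    move=> e e0; have [n [h h1]] := ul _ e0.
    rewrite -(subrKA (u n.+1)) mulr_natl mulr2n rmorphD /=.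
    rewrite (le_trans (ler_normD _ _))// lerD//.
    rewrite distrC; apply: (@le_trans _ _ (r%:C * `|l - u n|)).
      exact: (Flip l (u n) lr (un n)).
    apply: le_trans h; rewrite ler_piMl//.
    by rewrite lecR ltW.
  transitivity (1 - (l + l) + l * l); first by cring.
  rewrite {1 2}lF /F.
  have h2 : (2 : R[i]) * (2^-1)%:C = 1.
    by rewrite -(rmorph_nat (real_complex R) 2) -rmorphM mulfV ?pnatr_eq0// rmorph1.
  transitivity (1 - sc (2 * (2^-1)%:C) * (x + l * l) + l * l).
    by rewrite rmorphM rmorph_nat; cring.
  by rewrite h2 rmorph1; cring.
Qed.

End square_roots.

(** * Sums of squares *)

Section sums_of_squares.
Context {R : realType} {A : cstarAlgType R}.
Implicit Types (a b h x y : A) (r t : R).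

Definition real_elt (r : R) : A := sc r%:C.

Fact real_elt_is_zmod_morphism : zmod_morphism real_elt.
Proof. by move=> r s; rewrite /real_elt !rmorphB. Qed.
Fact real_elt_is_monoid_morphism : GRing.monoid_morphism real_elt.
Proof. by split=> [|r s]; rewrite /real_elt ?rmorph1// !rmorphM. Qed.
HB.instance Definition _ :=
  GRing.isZmodMorphism.Build R A real_elt real_elt_is_zmod_morphism.
HB.instance Definition _ :=
  GRing.isMonoidMorphism.Build R A real_elt real_elt_is_monoid_morphism.
Local Notation rs := real_elt.

Lemma star_real_elt r : star (rs r) = rs r. Proof. exact: star_real. Qed.
Lemma norm_real_elt r : 0 <= r -> `|rs r| <= r%:C.
Proof. exact: norm_real_scalar_le. Qed.
Lemma norm_real_eltM r a : 0 <= r -> `|rs r * a| = r%:C * `|a|.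
Proof. by move=> r0; rewrite -scale_scalar normrZ normc_real. Qed.

Inductive sum_of_squares : A -> Prop :=
| sos_sqr x : star x = x -> sum_of_squares (x * x)
| sosD a b : sum_of_squares a -> sum_of_squares b -> sum_of_squares (a + b).
Local Notation sos := sum_of_squares.

Hypothesis AC : commutative (fun a b : A => a * b).

Lemma starMC a b : star (a * b) = star a * star b.
Proof. by rewrite starM; exact: AC. Qed.

Lemma sos_star a : sos a -> star a = a.
Proof.
by elim=> [x sx|a' b' _ sa _ sb]; rewrite ?starM ?starD ?sx ?sa ?sb.
Qed.

Lemma sosM a b : sos a -> sos b -> sos (a * b).
Proof.
move=> + sb; elim=> [x sx|a1 a2 _ s1 _ s2]; last by rewrite mulrDl; exact: sosD.
elim: sb => [y sy|b1 b2 _ s1 _ s2]; last by rewrite mulrDr; exact: sosD.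
rewrite (_ : _ * _ = (x * y) * (x * y)); last by cring.
by apply: sos_sqr; rewrite starMC sx sy.
Qed.

Lemma sos_real r : 0 <= r -> sos (rs r).
Proof.
move=> r0; rewrite -(sqr_sqrtr r0) expr2 rmorphM.
by apply: sos_sqr; exact: star_real_elt.
Qed.

(** The explicit form of the root shows that every character is positive on it,
    which is what singles out the positive square root later. *)
Lemma sqrt_real_sub h t : star h = h -> `|h| < t%:C ->
  exists w u : A, [/\ star w = w, w * w = rs t - h,
    w = rs (Num.sqrt t) * (1 - u) & `|u| < 1].
Proof.
move=> sh ht; have t0 : 0 < t by rewrite -ltcR; apply: le_lt_trans ht.
have [n n0 hn] := norm_real h; rewrite hn ltcR in ht.
have nt : 0 <= n / t < 1.
  by apply/andP; split; [exact: divr_ge0 (ltW t0) | rewrite ltr_pdivrMr// mul1r].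
have sx : star (rs t^-1 * h) = rs t^-1 * h by rewrite starMC star_real_elt sh.
have [|u [su un uE]] := sqrt_one_minus AC sx nt.
  by rewrite norm_real_eltM ?invr_ge0 ?(ltW t0)// hn -rmorphM lecR mulrC.
exists (rs (Num.sqrt t) * (1 - u)), u; split => //.
- by rewrite starMC star_real_elt starB star1 su.
- transitivity (rs (Num.sqrt t * Num.sqrt t) * ((1 - u) * (1 - u))).
    by rewrite rmorphM; cring.
  rewrite uE -expr2 sqr_sqrtr ?ltW//.
  transitivity (rs t - rs (t * t^-1) * h); first by rewrite rmorphM; cring.
  by rewrite mulfV ?gt_eqF// rmorph1 mul1r.
- by apply: le_lt_trans un _; rewrite ltcR; case/andP: nt.
Qed.

Lemma sos_real_sub h t : star h = h -> `|h| < t%:C -> sos (rs t - h).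
Proof.
by move=> sh ht; have [w [_ [sw <- _ _]]] := sqrt_real_sub sh ht; exact: sos_sqr.
Qed.

(** The norm form of positivity, stable under sums. For one square x^2, the
    element t - x^2 is a square w^2, and |w^2| is at most |w^2 + x^2|, the norm
    of the constant t. *)
Lemma sos_norm_sub y : sos y -> exists2 t : R, 0 <= t & `|rs t - y| <= t%:C.
Proof.
elim=> [x sx|a b _ [t t0 ta] _ [s s0 sb]]; last first.
  exists (t + s); first exact: addr_ge0.
  rewrite (_ : _ - _ = (rs t - a) + (rs s - b)); last by rewrite rmorphD; cring.
  by rewrite rmorphD /=; apply: le_trans (ler_normD _ _) _; exact: lerD.
have [t t0 xt] := norm_lt_real (x * x); exists t => //.
have sxx : star (x * x) = x * x by rewrite starMC sx.
have [w [_ [sw wE _ _]]] := sqrt_real_sub sxx xt.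
rewrite -wE; apply: le_trans (norm_sqr_le AC sw sx) _.
by rewrite wE subrK; exact: norm_real_elt.
Qed.

(** A sum of squares becomes a single square after adding a positive constant:
    y + r = (t + r) - (t - y) with |t - y| < t + r. *)
Lemma sos_addr_sqr y r : sos y -> 0 < r ->
  exists w u : A, [/\ star w = w, w * w = y + rs r,
    exists2 t, 0 < t & w = rs t * (1 - u) & `|u| < 1].
Proof.
move=> sy r0; have [t t0 ty] := sos_norm_sub sy.
have tr0 : 0 < t + r by exact: ltr_wpDl.
have [||w [u [sw wE wu u1]]] := @sqrt_real_sub (rs t - y) (t + r).
- by rewrite starB star_real_elt sos_star.
- by apply: le_lt_trans ty _; rewrite ltcR ltrDl.
exists w, u; split=> //; first by rewrite wE rmorphD; cring.
by exists (Num.sqrt (t + r)) => //; rewrite sqrtr_gt0.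
Qed.

(** A bound in the order is a bound in norm: up to e, the element t - h^2 is a
    square w^2, and |h^2| is at most |h^2 + w^2|. *)
Lemma sos_norm_sqr h t : star h = h -> sos (rs t - h * h) -> 0 <= t ->
  `|h * h| <= t%:C.
Proof.
move=> sh sth t0; apply: (@le_normc_addeps _ _ _ _ 1) => // e e0.
have [w [_ [sw wE _ _]]] := sos_addr_sqr sth e0.
apply: le_trans (norm_sqr_le AC sh sw) _.
have -> : h * h + w * w = rs (t + e) by rewrite wE rmorphD; cring.
by rewrite mul1r norm_real_elt// addr_ge0// ltW.
Qed.

Lemma invertible_sub1 x : `|x| < 1 -> exists y, (1 - x) * y = 1.
Proof.
move=> /geometric_fixpoint[s sE]; exists (1 + s).
rewrite mulrBl mul1r mulrDr mulr1.
by rewrite opprD addrA -[in LHS]addrA {1}sE; cring.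
Qed.

(** 1 + p = (t + 1) (1 - z) where z = (t - p) / (t + 1) has norm below 1. *)
Lemma sos_add1_inv p : sos p -> exists y, (1 + p) * y = 1.
Proof.
move=> sp; have [t t0 tp] := sos_norm_sub sp.
have t1 : 0 < t + 1 by exact: ltr_wpDl.
pose z := rs (t + 1)^-1 * (rs t - p).
have [|y yE] := @invertible_sub1 z.
  rewrite norm_real_eltM ?invr_ge0 ?(ltW t1)//.
  apply: (@le_lt_trans _ _ ((t + 1)^-1%:C * t%:C)).
    by rewrite ler_wpM2l// ler0c invr_ge0 ltW.
  by rewrite -rmorphM ltcR mulrC ltr_pdivrMr// mul1r ltrDl.
exists (rs (t + 1)^-1 * y).
have -> : 1 + p = rs (t + 1) * (1 - z).
  transitivity (rs (t + 1) - rs ((t + 1) * (t + 1)^-1) * (rs t - p)).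
    by rewrite mulfV ?gt_eqF// rmorph1 rmorphD rmorph1; cring.
  by rewrite /z rmorphM; cring.
transitivity (rs ((t + 1) * (t + 1)^-1) * ((1 - z) * y)).
  by rewrite [in RHS]rmorphM; cring.
by rewrite yE mulfV ?gt_eqF// rmorph1 mul1r.
Qed.

(** Woermann's argument. With n a bound of q, the identity
    n (a + r - 1/n) = (n - q) (a + r) + r q + p shows that if a + r is a sum of
    squares then so is a + (r - 1/n). Starting from r above |a|, finitely many
    steps reach r below 0. *)
Lemma sos_of_mul_eq_add1 a p q : star a = a -> sos p -> sos q -> a * q = 1 + p -> sos a.
Proof.
move=> sa sp sq aq; have [n n0 qn] := norm_lt_real q.
have {}n0 : 0 < n by rewrite -ltcR; exact: le_lt_trans (normr_ge0 q) qn.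
have step r : 0 <= r -> sos (a + rs r) -> sos (a + rs (r - n^-1)).
  move=> r0 sar; have snq : sos (rs n - q) by apply: sos_real_sub => //; exact: sos_star.
  have -> : a + rs (r - n^-1) =
      rs n^-1 * ((rs n - q) * (a + rs r) + rs r * q + p).
    transitivity (rs n^-1 * ((rs n - q) * (a + rs r) + rs r * q + a * q - 1)); last first.
      by rewrite aq; cring.
    transitivity (rs (n^-1 * n) * a + rs (n^-1 * n) * rs r - rs n^-1).
      by rewrite mulVf ?gt_eqF// rmorph1 rmorphB; cring.
    by rewrite rmorphM; cring.
  apply: sosM; first by apply: sos_real; rewrite invr_ge0 ltW.
  apply: sosD => //; apply: sosD; first exact: sosM.
  by apply: sosM => //; exact: sos_real.
have sosW r : r <= 0 -> sos (a + rs r) -> sos a.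
  move=> r0 sar; rewrite -(addrK (rs r) a) -rmorphN; apply: sosD => //.
  by apply: sos_real; rewrite oppr_ge0.
have [t t0 at_] := norm_lt_real (- a).
have key k : sos a \/ sos (a + rs (t - k%:R * n^-1)).
  elim: k => [|k [|ih]]; [|by left|].
    right; rewrite mul0r subr0 addrC -[a]opprK; apply: sos_real_sub => //.
    by rewrite starN sa.
  have [r0|/ltW r0] := leP 0 (t - k%:R * n^-1); last by left; exact: sosW ih.
  right; move: (step _ r0 ih).
  by rewrite -[k.+1%:R]natr1 mulrDl mul1r opprD addrA.
have [k] : exists k : nat, t * n < k%:R.
  by exists (Num.bound (t * n)); apply: archi_boundP; rewrite mulr_ge0// ltW.
move=> tk; have [//|] := key k; apply: sosW.
by rewrite subr_le0 ler_pdivlMr// ltW.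
Qed.

End sums_of_squares.
Notation sos := sum_of_squares.
Notation rs := real_elt.

(** * Characters from maximal preorderings *)

Section preorderings.
Context {R : realType} {A : cstarAlgType R}.
Hypothesis AC : commutative (fun a b : A => a * b).
Implicit Types (a b g h p q x y : A) (r c e : R) (z : R[i]) (Q : set A).

Record preordering Q : Prop := Preordering {
  preordering_star : forall a, Q a -> star a = a;
  preordering_sqr : forall x, star x = x -> Q (x * x);
  preorderingD : forall a b, Q a -> Q b -> Q (a + b);
  preorderingM : forall a b, Q a -> Q b -> Q (a * b);
  preordering_proper : ~ Q (-1)
}.

Definition adjoin Q a : set A :=
  [set b | exists p q, [/\ Q p, Q q & b = p + a * q]].

Lemma preordering_sos : ~ sos (-1 : A) -> preordering sos.
Proof.
split=> //; [exact: sos_star|exact: sos_sqr|exact: sosD|exact: sosM].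
Qed.

Lemma preordering0 Q : preordering Q -> Q 0.
Proof.
by move=> QP; rewrite -(mul0r 0); apply: preordering_sqr => //; rewrite -(subrr 1) starB star1.
Qed.

Lemma preordering1 Q : preordering Q -> Q 1.
Proof. by move=> QP; rewrite -(mul1r 1); apply: preordering_sqr => //; exact: star1. Qed.

Lemma preordering_real Q r : preordering Q -> 0 <= r -> Q (rs r).
Proof.
move=> QP r0; rewrite -(sqr_sqrtr r0) expr2 rmorphM.
by apply: preordering_sqr => //; exact: star_real_elt.
Qed.

Lemma preordering_real_ge0 Q r : preordering Q -> Q (rs r) -> 0 <= r.
Proof.
move=> QP Qr; rewrite leNgt; apply/negP => r0; apply: (preordering_proper QP).
have -> : -1 = rs (- r^-1) * rs r :> A.
  by rewrite -rmorphM mulNr mulVf ?lt_eqF// rmorphN rmorph1.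
by apply: preorderingM => //; apply: preordering_real; rewrite // oppr_ge0 invr_le0 ltW.
Qed.

(** Products stay of the form p + a q because a^2 is a square. *)
Lemma preordering_adjoin Q a : preordering Q -> star a = a ->
  ~ adjoin Q a (-1) -> preordering (adjoin Q a).
Proof.
move=> QP sa Qa; split=> //.
- move=> _ [p [q [Qp Qq ->]]].
  by rewrite starD (starMC AC) sa !(preordering_star QP).
- move=> x sx; exists (x * x), 0; rewrite mulr0 addr0; split=> //.
    exact: preordering_sqr.
  exact: preordering0.
- move=> _ _ [p [q [Qp Qq ->]]] [p' [q' [Qp' Qq' ->]]].
  exists (p + p'), (q + q'); split; [exact: preorderingD..|by cring].
- move=> _ _ [p [q [Qp Qq ->]]] [p' [q' [Qp' Qq' ->]]].
  exists (p * p' + a * a * (q * q')), (p * q' + p' * q); split; last by cring.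
    apply: preorderingD => //; first exact: preorderingM.
    by apply: preorderingM => //; [exact: preordering_sqr|exact: preorderingM].
  by apply: preorderingD => //; apply: preorderingM.
Qed.

Lemma sub_adjoin Q a : preordering Q -> Q `<=` adjoin Q a.
Proof.
by move=> QP p Qp; exists p, 0; rewrite mulr0 addr0; split=> //; exact: preordering0.
Qed.

Lemma adjoin_mem Q a : preordering Q -> adjoin Q a a.
Proof.
move=> QP; exists 0, 1; rewrite mulr1 add0r.
by split=> //; [exact: preordering0|exact: preordering1].
Qed.

Definition maximal_preordering Q :=
  preordering Q /\ forall Q', preordering Q' -> Q `<=` Q' -> Q' `<=` Q.

Lemma maximal_preordering_exists Q0 : preordering Q0 ->
  exists2 Q, Q0 `<=` Q & maximal_preordering Q.
Proof.
move=> Q0P.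
(* The empty set is admitted so that the union of the empty chain qualifies. *)
pose P Q := Q = set0 \/ (preordering Q /\ Q0 `<=` Q).
have [F FP Ftot|Q [PQ Qmax]] := @Zorn_bigcup A P.
  have [[Q1 [FQ1 [a0 Qa0]]]|noQ] := pselect (exists Q, F Q /\ Q !=set0); last first.
    left; apply/seteqP; split=> // a [Q FQ Qa]; apply: noQ.
    by exists Q; split=> //; exists a.
  have FP' Q a : F Q -> Q a -> preordering Q /\ Q0 `<=` Q.
    by move=> FQ Qa; have [Q00|//] := FP _ FQ; rewrite Q00 in Qa.
  have F2 a b : (\bigcup_(X in F) X) a -> (\bigcup_(X in F) X) b ->
      exists Q, [/\ F Q, preordering Q, Q a & Q b].
    move=> [Q FQ Qa] [Q' FQ' Qb].
    have [QQ'|Q'Q] := Ftot _ _ FQ FQ'.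
      by exists Q'; split=> //; [exact: (FP' _ b _ _).1|exact: QQ'].
    by exists Q; split=> //; [exact: (FP' _ a _ _).1|exact: Q'Q].
  have [Q1P Q1Q0] := FP' _ _ FQ1 Qa0.
  right; split; last by move=> a /Q1Q0 Qa; exists Q1.
  split.
  - by move=> a [Q FQ Qa]; apply: (preordering_star (FP' _ _ FQ Qa).1).
  - by move=> x sx; exists Q1 => //; exact: preordering_sqr.
  - by move=> a b /F2 h /h[Q [FQ QP Qa Qb]]; exists Q => //; exact: preorderingD.
  - by move=> a b /F2 h /h[Q [FQ QP Qa Qb]]; exists Q => //; exact: preorderingM.
  - by move=> [Q FQ Qa]; apply: (preordering_proper (FP' _ _ FQ Qa).1).
have Q0ne : Q0 0 by exact: preordering0.
have [Q0E|[QP Q0Q]] := PQ.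
  exfalso; apply: (Qmax Q0); last by right; split.
  by rewrite Q0E; split=> // /(_ _ Q0ne).
exists Q => //; split=> // Q' Q'P QQ'; apply: contrapT => nQ'Q.
by apply: (Qmax Q'); [split | right; split=> // a /Q0Q /QQ'].
Qed.

Section maximal.
Context {Q : set A} (Qmax : maximal_preordering Q).
Let QP : preordering Q := Qmax.1.

Lemma maximal_adjoin a : star a = a -> ~ Q a -> adjoin Q a (-1).
Proof.
move=> sa nQa; apply: contrapT => n1; apply: nQa.
by apply: (Qmax.2 (adjoin Q a)); [exact: preordering_adjoin|exact: sub_adjoin|exact: adjoin_mem].
Qed.

(** If neither a nor - a belongs to Q, then -1 = p + a q = p' - a q' by
    maximality, and multiplying - a q = 1 + p by a q' = 1 + p' expresses -1 in
    Q. *)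
Lemma maximal_total a : star a = a -> Q a \/ Q (- a).
Proof.
move=> sa; apply: contrapT => /not_orP[/(maximal_adjoin sa)[p [q [Qp Qq pE]]]].
have sna : star (- a) = - a by rewrite starN sa.
move=> /(maximal_adjoin sna)[p' [q' [Qp' Qq' pE']]].
apply: (preordering_proper QP).
have -> : -1 = p + p' + p * p' + a * a * (q * q').
  transitivity (p + p' + p * p' + (-1 - p) * (1 + p')); first by cring.
  have -> : -1 - p = a * q by rewrite {1}pE; cring.
  have -> : 1 + p' = a * q'.
    by rewrite -[1]opprK {1}pE'; cring.
  by cring.
apply: preorderingD => //.
  by apply: preorderingD => //; [exact: preorderingD|exact: preorderingM].
by apply: preorderingM => //; [exact: preordering_sqr|exact: preorderingM].
Qed.

(** The elements on which the character will vanish, within the self-adjoint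
    part. *)
Definition infinitesimal g := forall e, 0 < e -> Q (rs e + g) /\ Q (rs e - g).

Lemma infinitesimal_star g : infinitesimal g -> star g = g.
Proof.
move=> /(_ 1 ltr01)[/(preordering_star QP) + _].
by rewrite starD star_real_elt => /addrI.
Qed.

Lemma infinitesimal0 : infinitesimal 0.
Proof.
by move=> e e0; rewrite addr0 subr0; split; apply: preordering_real; rewrite // ltW.
Qed.

Lemma infinitesimalN g : infinitesimal g -> infinitesimal (- g).
Proof. by move=> gs e e0; have [? ?] := gs e e0; rewrite opprK. Qed.

Lemma infinitesimalD g h :
  infinitesimal g -> infinitesimal h -> infinitesimal (g + h).
Proof.
move=> gs hs e e0; have e2 : 0 < e / 2 by rewrite divr_gt0.
have [g1 g2] := gs _ e2; have [h1 h2] := hs _ e2.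
rewrite [e]splitr rmorphD; split.
  by rewrite addrACA; exact: preorderingD.
by rewrite opprD addrACA; exact: preorderingD.
Qed.

Lemma infinitesimal_scale g c : infinitesimal g -> infinitesimal (rs c * g).
Proof.
wlog c0 : c / 0 < c => [wl|].
  have [/wl//|c0 gs|<-] := ltgtP 0 c; last by rewrite rmorph0 mul0r => _; exact: infinitesimal0.
  rewrite -[c]opprK rmorphN mulNr; apply: infinitesimalN; apply: wl => //.
  by rewrite oppr_gt0.
move=> gs e e0; have [] := gs (e / c); first by rewrite divr_gt0.
have Qc : Q (rs c) by apply: preordering_real; rewrite // ltW.
have {3 4}-> : e = c * (e / c) by rewrite mulrC divfK ?gt_eqF.
rewrite [rs (c * _)]rmorphM -mulrDr -mulrBr => h1 h2.
by split; apply: preorderingM.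
Qed.

(** e - g^2 = (d - g) (d + g) with d^2 = e. *)
Lemma infinitesimal_sqr g : infinitesimal g -> infinitesimal (g * g).
Proof.
move=> gs e e0; have sg := infinitesimal_star gs.
have d0 : 0 < Num.sqrt e by rewrite sqrtr_gt0.
have [h1 h2] := gs _ d0; split.
  apply: preorderingD => //; last exact: preordering_sqr.
  by apply: preordering_real; rewrite // ltW.
have -> : rs e - g * g = (rs (Num.sqrt e) + g) * (rs (Num.sqrt e) - g).
  by rewrite -{1}(sqr_sqrtr (ltW e0)) expr2 rmorphM; cring.
exact: preorderingM.
Qed.

Lemma infinitesimalM g h :
  infinitesimal g -> infinitesimal h -> infinitesimal (g * h).
Proof.
move=> gs hs.
have -> : g * h = rs (2^-1) * ((g + h) * (g + h) + (- (g * g) + - (h * h))).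
  transitivity (rs (2^-1 * 2) * (g * h)); last by rewrite rmorphM rmorph_nat; cring.
  by rewrite mulVf ?pnatr_eq0// rmorph1 mul1r.
apply: infinitesimal_scale; apply: infinitesimalD.
  exact/infinitesimal_sqr/infinitesimalD.
by apply: infinitesimalD; exact/infinitesimalN/infinitesimal_sqr.
Qed.

Lemma infinitesimal_real c : infinitesimal (rs c) -> c = 0.
Proof.
move=> cs; apply/le_anti/andP; split; apply/ler_addgt0Pr => e e0.
  have [_] := cs _ e0; rewrite -rmorphB => /(preordering_real_ge0 QP).
  by rewrite add0r subr_ge0.
have [+ _] := cs _ e0; rewrite -rmorphD => /(preordering_real_ge0 QP).
by rewrite addrC.
Qed.

(** The standard part is the supremum of the reals r with h - r in Q; totality
    gives the upper estimate, and sums of squares (through the norm) show that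
    the supremum is finite. *)
Lemma standard_part_exists h : star h = h -> exists c, infinitesimal (h - rs c).
Proof.
move=> sh; pose S := [set r | Q (h - rs r)].
have [t t0 ht] := norm_lt_real h.
have Qsos a : sos a -> Q a.
  by elim=> [x sx|b b' _ ? _ ?]; [exact: preordering_sqr|exact: preorderingD].
have hS : has_sup S.
  split.
    exists (- t); rewrite /S /= rmorphN opprK -[h]opprK addrC; apply: Qsos.
    by apply: (sos_real_sub AC); rewrite ?starN ?sh ?normrN.
  exists t => r Sr; rewrite -subr_ge0; apply: (preordering_real_ge0 QP).
  have -> : rs (t - r) = (rs t - h) + (h - rs r) by rewrite subrKA rmorphB.
  by apply: preorderingD => //; apply/Qsos/(sos_real_sub AC).
exists (sup S) => e e0; split.
  have [r Sr re] := sup_adherent e0 hS.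
  have -> : rs e + (h - rs (sup S)) = (h - rs r) + rs (r - (sup S - e)).
    by rewrite !rmorphB; cring.
  apply: preorderingD => //; apply: preordering_real => //.
  by rewrite subr_ge0 ltW.
have -> : rs e - (h - rs (sup S)) = - (h - rs (sup S + e)).
  by rewrite rmorphD; cring.
have [|Sn|//] := @maximal_total (h - rs (sup S + e)).
  by rewrite starB sh star_real_elt.
have := sup_upper_bound hS Sn; rewrite gerDl leNgt e0 //.
Qed.

(** The values are taken separately on the two parts of a = x + i y. As a
    relation with existential x and y, it is visibly compatible with sums,
    products and the star; uniqueness of the parts makes it functional. *)
Definition standard_part a z := exists x y,
  [/\ a = x + sc 'i%C * y, infinitesimal (x - rs (complex.Re z))
    & infinitesimal (y - rs (complex.Im z))].

Lemma sub_real_star x c : infinitesimal (x - rs c) -> star x = x.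
Proof.
by move=> /infinitesimal_star; rewrite starB star_real_elt => /addIr.
Qed.

Lemma cartesian_unique x y x' y' : star x = x -> star y = y ->
  star x' = x' -> star y' = y' ->
  x + sc 'i%C * y = x' + sc 'i%C * y' -> x = x' /\ y = y'.
Proof.
move=> sx sy sx' sy' e1; have := congr1 (@star R A) e1.
rewrite !starD !(starMC AC) sx sy sx' sy' star_scalar_i !mulNr => e2.
have x2 : x + x = x' + x'.
  transitivity ((x + sc 'i%C * y) + (x - sc 'i%C * y)); first by cring.
  by rewrite e1 e2; cring.
have half (b : A) : b = rs (2^-1) * (b + b).
  transitivity (rs (2^-1 * 2) * b); last by rewrite rmorphM rmorph_nat; cring.
  by rewrite mulVf ?pnatr_eq0// rmorph1 mul1r.
have xx' : x = x' by rewrite (half x) x2 -half.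
split=> //; move: e1; rewrite xx' => /addrI /(congr1 (fun v => - sc 'i%C * v)).
by rewrite !mulrA mulNr scalar_i_sqr opprK !mul1r.
Qed.

Lemma standard_part_total a : exists z, standard_part a z.
Proof.
pose x : A := rs 2^-1 * (a + star a).
pose y : A := - sc 'i%C * (rs 2^-1 * (a - star a)).
have sx : star x = x by rewrite (starMC AC) star_real_elt starD starK addrC.
have sy : star y = y.
  rewrite !(starMC AC) star_real_elt starB starN star_scalar_i starK /y.
  by cring.
have [c cx] := standard_part_exists sx; have [d dy] := standard_part_exists sy.
exists (c +i* d), x, y; split=> //.
have -> : x + sc 'i%C * y =
    x - (sc 'i%C * sc 'i%C) * (rs 2^-1 * (a - star a)) by rewrite /y; cring.
rewrite scalar_i_sqr mulN1r opprK /x -mulrDr.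
transitivity (rs (2^-1 * 2) * a); last by rewrite rmorphM rmorph_nat; cring.
by rewrite mulVf ?pnatr_eq0// rmorph1 mul1r.
Qed.

Lemma standard_part_unique a z z' :
  standard_part a z -> standard_part a z' -> z = z'.
Proof.
have U b c c' : infinitesimal (b - rs c) -> infinitesimal (b - rs c') -> c = c'.
  move=> /infinitesimalN h1 /(infinitesimalD h1).
  rewrite (_ : _ + _ = rs (c - c')); last by rewrite rmorphB; cring.
  by move=> /infinitesimal_real /eqP; rewrite subr_eq0 => /eqP.
move=> [x [y [-> xz yz]]] [x' [y' [e xz' yz']]].
have [xx yy] := cartesian_unique (sub_real_star xz) (sub_real_star yz)
  (sub_real_star xz') (sub_real_star yz') e.
move: xz' yz'; rewrite -xx -yy => /(U _ _ _ xz) h1 /(U _ _ _ yz) h2.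
by move: h1 h2; case: (z) (z') => [? ?] [? ?] /= -> ->.
Qed.

Lemma standard_partD a b z w :
  standard_part a z -> standard_part b w -> standard_part (a + b) (z + w).
Proof.
move=> [x [y [-> xz yz]]] [x' [y' [-> xw yw]]].
exists (x + x'), (y + y'); split; first by cring.
  rewrite (_ : _ - _ = (x - rs (complex.Re z)) + (x' - rs (complex.Re w))).
    exact: infinitesimalD.
  by case: z w {xz yz xw yw} => [? ?] [? ?] /=; rewrite rmorphD; cring.
rewrite (_ : _ - _ = (y - rs (complex.Im z)) + (y' - rs (complex.Im w))).
  exact: infinitesimalD.
by case: z w {xz yz xw yw} => [? ?] [? ?] /=; rewrite rmorphD; cring.
Qed.

Lemma sub_realM x y c d : infinitesimal (x - rs c) -> infinitesimal (y - rs d) ->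
  infinitesimal (x * y - rs (c * d)).
Proof.
move=> xc yd.
have -> : x * y - rs (c * d) =
    (x - rs c) * (y - rs d) + (rs d * (x - rs c) + rs c * (y - rs d)).
  by rewrite rmorphM; cring.
apply: infinitesimalD; first exact: infinitesimalM.
by apply: infinitesimalD; exact: infinitesimal_scale.
Qed.

Lemma standard_partM a b z w :
  standard_part a z -> standard_part b w -> standard_part (a * b) (z * w).
Proof.
move=> [x [y [-> xz yz]]] [x' [y' [-> xw yw]]].
exists (x * x' - y * y'), (x * y' + y * x'); split.
- transitivity (x * x' + sc 'i%C * sc 'i%C * (y * y') + sc 'i%C * (x * y' + y * x')); first by cring.
  by rewrite scalar_i_sqr mulN1r.
- rewrite (_ : _ - _ = (x * x' - rs (complex.Re z * complex.Re w))
      + - (y * y' - rs (complex.Im z * complex.Im w))).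
    by apply: infinitesimalD; [|apply: infinitesimalN]; exact: sub_realM.
  by case: z w {xz yz xw yw} => [? ?] [? ?] /=; rewrite rmorphB; cring.
- rewrite (_ : _ - _ = (x * y' - rs (complex.Re z * complex.Im w))
      + (y * x' - rs (complex.Im z * complex.Re w))).
    by apply: infinitesimalD; exact: sub_realM.
  by case: z w {xz yz xw yw} => [? ?] [? ?] /=; rewrite rmorphD; cring.
Qed.

Lemma standard_part_scalar z : standard_part (sc z) z.
Proof.
exists (rs (complex.Re z)), (rs (complex.Im z)); rewrite !subrr.
split; [|exact: infinitesimal0..].
by rewrite {1}[z]complexE rmorphD rmorphM.
Qed.

Lemma standard_part_star a z : standard_part a z -> standard_part (star a) (z^*)%R.
Proof.
move=> [x [y [-> xz yz]]]; exists x, (- y); split.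
- rewrite starD (starMC AC) star_scalar_i (sub_real_star xz) (sub_real_star yz).
  by cring.
- by case: z xz yz.
- rewrite (_ : _ - _ = - (y - rs (complex.Im z))); first exact: infinitesimalN.
  by case: z {xz yz} => ? ? /=; rewrite rmorphN; cring.
Qed.

Definition standard_character a : R[i] := xget 0 (standard_part a).

Lemma standard_characterP a : standard_part a (standard_character a).
Proof. exact: xgetPex (standard_part_total a). Qed.

Lemma standard_characterE a z : standard_part a z -> standard_character a = z.
Proof. exact/standard_part_unique/standard_characterP. Qed.

Lemma standard_character_character : character standard_character.
Proof.
have M a b : standard_character (a * b) = standard_character a * standard_character b.
  by apply/standard_characterE/standard_partM; exact: standard_characterP.
split=> [k a b||a].
- apply: standard_characterE; rewrite scale_scalar.
  apply: standard_partD; last exact: standard_characterP.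
  by apply: standard_partM; [exact: standard_part_scalar|exact: standard_characterP].
- split=> //; apply: standard_characterE; rewrite -(rmorph1 (@scalar_elt R A)).
  exact: standard_part_scalar.
- by apply/standard_characterE/standard_part_star/standard_characterP.
Qed.

Lemma standard_character_le0 a : Q (- a) -> standard_character a <= 0.
Proof.
move=> Qa; have sa : star a = a.
  by rewrite -[a]opprK starN (preordering_star QP Qa).
have [c ac] := standard_part_exists sa.
rewrite (@standard_characterE a c%:C); last first.
  exists a, 0; rewrite mulr0 addr0 /= rmorph0 subrr; split=> //.
  exact: infinitesimal0.
rewrite -[0]/(0%:C) lecR; apply/ler_addgt0Pr => e e0; rewrite add0r -subr_ge0.
apply: (preordering_real_ge0 QP); have [h _] := ac _ e0.
rewrite (_ : rs _ = (rs e + (a - rs c)) + - a); first exact: preorderingD.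
by rewrite rmorphB; cring.
Qed.

End maximal.

(** The alternative is whether -1 belongs to the preordering generated by the
    sums of squares and - a. If -1 is itself a sum of squares, p = -1 and q = 0
    serve. *)
Theorem character_le0_or_positive a : star a = a ->
  (exists2 m : A -> R[i], character m & m a <= 0) \/
  (exists p q, [/\ sos p, sos q & a * q = 1 + p]).
Proof.
move=> sa; have [s1|s1] := pselect (sos (-1 : A)).
  right; exists (-1), (0 * 0); split=> //; last by rewrite mul0r mulr0 subrr.
  by apply: sos_sqr; rewrite -(subrr 1) starB star1.
have [[p [q [sp sq e]]]|n1] := pselect (adjoin sos (- a) (-1)).
  right; exists p, q; split=> //.
  by rewrite -[1]opprK {1}e; cring.
left; have sP := preordering_sos s1.
have [|Q sQ Qmax] := maximal_preordering_exists (preordering_adjoin sP _ n1).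
  by rewrite starN sa.
exists (@standard_character Q); first exact: standard_character_character.
by apply: standard_character_le0 => //; apply: sQ; exact: adjoin_mem.
Qed.

End preorderings.

(** * Gelfand theory *)

Section character_values.
Context {R : realType} {A : cstarAlgType R} (m : A -> R[i]) (mP : character m).
Implicit Types (a b : A) (r : R).

Lemma char0 : m 0 = 0.
Proof.
case: mP => ml _ _; have := ml (-1) 0 0.
by rewrite scaler0 addr0 mulN1r addNr.
Qed.
Lemma charD a b : m (a + b) = m a + m b.
Proof. by case: mP => ml _ _; have := ml 1 a b; rewrite scale1r mul1r. Qed.
Lemma charZ k a : m (k *: a) = k * m a.
Proof. by case: mP => ml _ _; have := ml k a 0; rewrite !addr0 char0 addr0. Qed.
Lemma charN a : m (- a) = - m a.
Proof. by rewrite -scaleN1r charZ mulN1r. Qed.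
Lemma charB a b : m (a - b) = m a - m b.
Proof. by rewrite charD charN. Qed.
Lemma charM a b : m (a * b) = m a * m b.
Proof. by case: mP => _ [_ mM] _; exact: mM. Qed.
Lemma char1 : m 1 = 1.
Proof. by case: mP => _ [-> _]. Qed.
Lemma char_sc k : m (sc k) = k.
Proof. by rewrite /scalar_elt charZ char1 mulr1. Qed.
Lemma char_rs r : m (rs r) = r%:C.
Proof. exact: char_sc. Qed.
Lemma char_star a : m (star a) = (m a)^*%R.
Proof. by case: mP. Qed.

Lemma char_real a : star a = a -> m a = (complex.Re (m a))%:C.
Proof. by move=> sa; apply: conjc_real; rewrite -char_star sa. Qed.

Lemma char_norm_sqr a : m (star a * a) = `|m a| ^+ 2.
Proof. by rewrite charM char_star mulrC normCK. Qed.

(** m b belongs to the spectrum of b, since m vanishes at m b - b. *)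
Lemma char_positive b : positive b -> 0 <= m b.
Proof.
move=> [_]; apply; move=> [c [+ _]] => /(congr1 m).
rewrite charM charB -/(sc _) char_sc subrr mul0r char1 => /eqP.
by rewrite eq_sym oner_eq0.
Qed.

End character_values.

Section gelfand.
Context {R : realType} {A : cstarAlgType R}.
Hypothesis AC : commutative (fun a b : A => a * b).
Implicit Types (a b h : A) (r t : R).

(** A character is nonpositive at a^* a only if it vanishes at a; otherwise
    a^* a q = 1 + p, and 1 + p is invertible. *)
Lemma invertible_of_char a : (forall m, character m -> m a != 0) -> invertible a.
Proof.
move=> ma; suff [b ab] : exists b, a * b = 1.
  by exists b; split=> //; rewrite [LHS]AC.
have sh : star (star a * a) = star a * a by rewrite starM starK.
have [[m mP]|[p [q [sp _ e]]]] := character_le0_or_positive AC sh.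
  rewrite (char_norm_sqr mP) => h; have := ma _ mP.
  by rewrite -normr_gt0 => /(exprn_gt0 2)/(le_lt_trans h); rewrite ltxx.
have [y yE] := sos_add1_inv AC sp.
exists (star a * q * y); rewrite -yE -e; cring.
Qed.

Lemma sos_of_char_gt0 a : star a = a ->
  (forall m, character m -> 0 < m a) -> sos a.
Proof.
move=> sa ma; have [[m mP]|[p [q [sp sq e]]]] := character_le0_or_positive AC sa.
  by move=> /(lt_le_trans (ma _ mP)); rewrite ltxx.
exact: (sos_of_mul_eq_add1 AC sa sp sq e).
Qed.

(** Every character is positive at t^2 + e - h^2, which is therefore a sum of
    squares. *)
Lemma norm_le_selfadjoint h t : 0 <= t -> star h = h ->
  (forall m, character m -> `|m h| <= t%:C) -> `|h| <= t%:C.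
Proof.
move=> t0 sh mh.
have : `|h * h| <= (t ^+ 2)%:C.
  apply: (@le_normc_addeps _ _ _ _ 1) => // e e0; rewrite mul1r.
  have te0 : 0 <= t ^+ 2 + e by rewrite addr_ge0 ?sqr_ge0// ltW.
  apply: (sos_norm_sqr AC) => //; apply: sos_of_char_gt0.
    by rewrite starB (starMC AC) sh star_real_elt.
  move=> m mP; rewrite (charB mP) (char_rs mP) -{1}sh (char_norm_sqr mP) subr_gt0.
  apply: (@le_lt_trans _ _ ((t ^+ 2)%:C)); last by rewrite ltcR ltrDl.
  by rewrite rmorphXn /= ler_pXn2r ?nnegrE// ?ler0c// mh.
by rewrite norm_sqr// rmorphXn /= ler_pXn2r ?nnegrE// ?ler0c.
Qed.

Lemma norm_le_char a t : 0 <= t ->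
  (forall m, character m -> `|m a| <= t%:C) -> `|a| <= t%:C.
Proof.
move=> t0 ma; rewrite -(@ler_pXn2r _ 2) ?nnegrE// ?ler0c//.
rewrite -norm_starM -rmorphXn /=; apply: norm_le_selfadjoint.
- exact: sqr_ge0.
- by rewrite starM starK.
- move=> m mP; rewrite (char_norm_sqr mP) ger0_norm ?exprn_ge0//.
  by rewrite rmorphXn /= ler_pXn2r ?nnegrE// ?ler0c// ma.
Qed.

Lemma char_separate a b : (forall m, character m -> m a = m b) -> a = b.
Proof.
move=> mab; apply/eqP; rewrite -subr_eq0 -normr_le0 -[0]/(0%:C).
apply: norm_le_char => // m mP.
by rewrite (charB mP) mab// subrr normr0.
Qed.

Lemma sqr_dist_le (x y d : R) : 0 <= x -> 0 <= y -> 0 <= d ->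
  y ^+ 2 <= x ^+ 2 -> x ^+ 2 <= y ^+ 2 + d ^+ 2 -> `|x - y| <= d.
Proof.
move=> x0 y0 d0; rewrite ler_pXn2r ?nnegrE// => yx h.
rewrite ger0_norm ?subr_ge0// -(@ler_pXn2r _ 2) ?nnegrE ?subr_ge0//.
nra.
Qed.

(** h + 4^-n has a square root w n on which characters are nonnegative. Norms are
    bounded through characters, so the w n converge like 2^-n, and the limit has
    the value of the square root of m h at every character m. *)
Lemma sqrt_exists h : star h = h -> (forall m, character m -> 0 <= m h) ->
  exists b, positive b /\ b * b = h.
Proof.
move=> sh mh; pose d n : R := 2^-1 ^+ n.
have d0 n : 0 < d n by rewrite exprn_gt0// invr_gt0.
have /choice[w wP] : forall n, exists w : A, [/\ star w = w,
    w * w = h + rs (d n ^+ 2) & forall m, character m -> 0 <= m w].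
  move=> n; have e0 : 0 < d n ^+ 2 / 2 by rewrite divr_gt0// exprn_gt0.
  have [|w [u [sw wE [t t0 wu] u1]]] := sos_addr_sqr AC (y := h + rs (d n ^+ 2 / 2)) _ e0.
    apply: sos_of_char_gt0; first by rewrite starD star_real_elt sh.
    by move=> m mP; rewrite (charD mP) (char_rs mP) ltr_wpDl ?mh// ltcR.
  exists w; split=> //; first by rewrite wE -addrA -rmorphD -splitr.
  move=> m mP; rewrite (char_real mP sw) ler0c.
  have := le_lt_trans (@character_le _ _ _ u mP) u1; rewrite wu (charM mP) (charB mP).
  rewrite (char_rs mP) (char1 mP).
  move=> /(le_lt_trans (normc_ge_Re _)); rewrite -[1]/(1%:C) ltcR ltr_norml => /andP[_].
  case: (m u) => x y /= x1; rewrite mul0r subr0 mulr_ge0 ?(ltW t0)//.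
  by rewrite subr_ge0 ltW.
have mw m n : character m -> exists x s, [/\ m (w n) = x%:C, m h = s%:C, 0 <= x,
    0 <= s & x ^+ 2 = s + d n ^+ 2].
  move=> mP; have [sw wE w0] := wP n; have := w0 _ mP; have := mh _ mP.
  have := congr1 m wE; rewrite (charM mP) (charD mP) (char_rs mP).
  rewrite (char_real mP sw) (char_real mP sh) !ler0c.
  set x := complex.Re _; set s := complex.Re _ => xs s0 x0; exists x, s; split=> //.
  by apply: complexI; rewrite expr2 rmorphM xs rmorphD.
have cw : cvgn w.
  apply: (@half_geometric_cvg _ _ _ 1).
  move=> n; rewrite mul1r -/(d n); apply: norm_le_char; first exact: ltW.
  move=> m mP; rewrite (charB mP).
  have [x [s [-> hs x0 s0 xE]]] := mw m n mP.
  have [y [s' [-> hs' y0 _ yE]]] := mw m n.+1 mP.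
  have ss' : s = s' by apply: complexI; rewrite -hs -hs'.
  rewrite -rmorphB norm_real_complex lecR distrC.
  have dS : d n.+1 = 2^-1 * d n by rewrite /d exprS.
  apply: sqr_dist_le; rewrite ?(ltW (d0 n))//.
    rewrite xE yE -ss' lerD2l dS; have := d0 n; nra.
  by rewrite xE yE -ss' -addrA lerD2l lerDr sqr_ge0.
pose b := limn w.
have mb m : character m -> exists2 s : R, m h = s%:C & m b = (Num.sqrt s)%:C.
  move=> mP; have [x0 [s [_ hs _ s0 _]]] := mw m 0%N mP; exists s => //.
  apply/eqP; rewrite -subr_eq0; apply/eqP; apply: (@norm_le_eps0 _ _ _ 2) => // e e0.
  have [n [wn dn]] := limn_half_approx cw e0.
  have [x [s' [mwx hs' x1 _ xE]]] := mw m n mP.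
  have ss' : s = s' by apply: complexI; rewrite -hs -hs'.
  rewrite -(subrKA (m (w n))) mulr_natl mulr2n rmorphD /=.
  apply: le_trans (ler_normD _ _) _; apply: lerD.
    rewrite -(charB mP); apply: le_trans (character_le _ mP) _.
    exact: wn.
  rewrite mwx -rmorphB norm_real_complex lecR.
  apply: (@le_trans _ _ (d n)) dn.
  apply: sqr_dist_le; rewrite ?sqrtr_ge0 ?(ltW (d0 n))// sqr_sqrtr// xE -ss'//.
  by rewrite lerDl sqr_ge0.
have sb : star b = b.
  apply: char_separate => m mP; rewrite (char_star mP).
  by have [s _ ->] := mb _ mP; exact: conjc_realE.
exists b; split; last first.
  apply: char_separate => m mP; rewrite (charM mP).
  have [s hs ->] := mb _ mP; rewrite hs -rmorphM -expr2 sqr_sqrtr//.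
  by rewrite -ler0c -hs mh.
split=> // z bz; apply: contrapT => z0; apply: bz.
apply: invertible_of_char => m mP; rewrite (charB mP) -/(sc _) (char_sc mP).
rewrite subr_eq0; apply/eqP => zE; apply: z0; rewrite zE.
by have [s _ ->] := mb _ mP; rewrite ler0c sqrtr_ge0.
Qed.

(** A character takes nonnegative values on positive elements, and a nonnegative
    number is determined by its square. *)
Lemma char_abs m a : character m -> m (cabs a) = `|m a|.
Proof.
move=> mP; have [||b bP] := @sqrt_exists (star a * a).
- by rewrite starM starK.
- by move=> n nP; rewrite (char_norm_sqr nP) exprn_ge0.
have [p0 pE] := xgetPex 0 (ex_intro _ b bP : exists b, positive b /\ b * b = star a * a).
apply/eqP; rewrite -(@eqrXn2 _ 2)// ?(char_positive mP)//.
by rewrite expr2 -(charM mP) -(char_norm_sqr mP) /cabs /csqrt pE.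
Qed.

Lemma char_meet m a b : character m ->
  m (cmeet a b) = 2^-1 * (m a + m b) - 2^-1 * `|m a - m b|.
Proof.
by move=> mP; rewrite /cmeet (charB mP) !(charZ mP) (char_abs _ mP) (charD mP) (charB mP).
Qed.

Lemma char_join m a b : character m ->
  m (cjoin a b) = 2^-1 * (m a + m b) + 2^-1 * `|m a - m b|.
Proof.
by move=> mP; rewrite /cjoin (charD mP) !(charZ mP) (char_abs _ mP) (charD mP) (charB mP).
Qed.

Lemma char_meet_real m a b (x y : R) : character m -> m a = x%:C -> m b = y%:C ->
  m (cmeet a b) = (Num.min x y)%:C.
Proof.
move=> mP ax by_; rewrite char_meet// ax by_ -rmorphB.
rewrite norm_real_complex half_complex -rmorphD -!rmorphM -rmorphB /=.
congr (_%:C); case: (lerP x y) => xy.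
  by lra.
by lra.
Qed.

Lemma char_join_real m a b (x y : R) : character m -> m a = x%:C -> m b = y%:C ->
  m (cjoin a b) = (Num.max x y)%:C.
Proof.
move=> mP ax by_; rewrite char_join// ax by_ -rmorphB.
rewrite norm_real_complex half_complex -rmorphD -!rmorphM -rmorphD /=.
congr (_%:C); case: (lerP x y) => xy.
  by lra.
by lra.
Qed.

End gelfand.

(** * Morphisms and lattice operations *)

Section star_morphisms.
Context {R : realType} {A B : cstarAlgType R}.
Hypotheses (AC : commutative (fun a b : A => a * b))
  (BC : commutative (fun a b : B => a * b)).
Variable (f : A -> B) (fM : star_morphism f).

Lemma char_comp n : character n -> character (n \o f).
Proof.
move=> nP; case: fM => fl [f1 fMul] fs; split=> [k a b||a] /=.
- by rewrite fl (charD nP) (charZ nP).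
- by split=> [|a b] /=; rewrite ?f1 ?(char1 nP)// fMul (charM nP).
- by rewrite fs (char_star nP).
Qed.

(** Tested on the characters n of the target: both n and its composite with f
    turn meets into the same expression in the values. *)
Lemma star_morphism_meet a b : f (cmeet a b) = cmeet (f a) (f b).
Proof.
apply: (char_separate BC) => n nP; have nfP := char_comp nP.
by rewrite (char_meet BC _ _ nP) -[LHS]/((n \o f) _) (char_meet AC _ _ nfP).
Qed.

Lemma star_morphism_join a b : f (cjoin a b) = cjoin (f a) (f b).
Proof.
apply: (char_separate BC) => n nP; have nfP := char_comp nP.
by rewrite (char_join BC _ _ nP) -[LHS]/((n \o f) _) (char_join AC _ _ nfP).
Qed.

Lemma pre_isocone_image (J : set A) :
  pre_isocone J -> closed (f @` J) -> pre_isocone (f @` J).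
Proof.
case: fM => fl [f1 fMul] fs [Jsa _ JD JZ Jm Jj J1] fJ.
have fZ k a : f (k *: a) = k *: f a.
  have f0 : f 0 = 0 by have := fl (-1) 0 0; rewrite scaler0 addr0 scaleN1r addNr.
  by have := fl k a 0; rewrite !addr0 f0 addr0.
split=> //.
- by move=> _ [a /Jsa sa <-]; rewrite /selfadjoint /= -fs sa.
- move=> _ _ [a Ja <-] [b Jb <-]; exists (a + b); first exact: JD.
  by rewrite -[a]scale1r fl !scale1r.
- by move=> r _ r0 [a Ja <-]; exists (r%:C *: a); [exact: JZ|exact: fZ].
- move=> _ _ [a Ja <-] [b Jb <-]; exists (cmeet a b); first exact: Jm.
  exact: star_morphism_meet.
- move=> _ _ [a Ja <-] [b Jb <-]; exists (cjoin a b); first exact: Jj.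
  exact: star_morphism_join.
- by move=> r; exists (r%:C *: (1 : A)); [exact: J1|rewrite fZ f1].
Qed.

End star_morphisms.

(** The closedness clause for g applies to the image of J under f because that
    image is again a pre-isocone. *)
Lemma istar_morphism_compose (R : realType) (X Y Z : abIstarAlgType R)
    (f : X -> Y) (g : Y -> Z) :
  istar_morphism (istar_cone X) (istar_cone Y) f ->
  istar_morphism (istar_cone Y) (istar_cone Z) g ->
  istar_morphism (istar_cone X) (istar_cone Z) (g \o f).
Proof.
move=> [fS fI fJ] [gS gI gJ]; split.
- case: fS gS => fl [f1 fM] fs [gl [g1 gM] gs]; split=> [k a b||a] /=.
  + by rewrite fl gl.
  + by split=> [|a b] /=; rewrite ?f1 ?g1// fM gM.
  + by rewrite fs gs.
- by move=> _ [a Ia <-]; apply: gI; exists (f a) => //; apply: fI; exists a.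
- move=> J JP JI; rewrite -image_comp; apply: gJ.
    exact: (pre_isocone_image (@ab_mulC R X) (@ab_mulC R Y) fS JP (fJ J JP JI)).
  by move=> _ [a Ja <-]; apply: fI; exists a => //; exact: JI.
Qed.

Section isometries.
Context {R : realType} {V W : completeNormedModType R[i]}.

Lemma closed_isometry_image (f : V -> W) (J : set V) :
  {morph f : a b / a - b} -> (forall a, `|f a| = `|a|) -> closed J ->
  closed (f @` J).
Proof.
move=> fB fN cJ h hJ; pose d n : R := 2^-1 ^+ n.
have d0 n : 0 < d n by rewrite exprn_gt0// invr_gt0.
have /choice[c cP] : forall n, exists c, J c /\ `|f c - h| <= (d n)%:C.
  move=> n; have [_ [[c Jc <-] hc]] := hJ _ (nbhsx_ballx h ((d n)%:C) ltac:(by rewrite ltcR)).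
  by exists c; split=> //; apply: ltW; move: hc; rewrite -ball_normE /= distrC.
have cc : cvgn c.
  apply: (@half_geometric_cvg _ _ _ 2).
  move=> n; rewrite -fN fB -/(d n) -(subrKA h) mulr_natl mulr2n rmorphD /=.
  apply: le_trans (ler_normD _ _) _; apply: lerD; last first.
    by rewrite distrC; exact: (cP n).2.
  apply: le_trans (cP n.+1).2 _; rewrite lecR /d exprS.
  by have := d0 n; rewrite /d; lra.
exists (limn c).
  by apply: (closed_cvg J cJ _ (limn c) cc); apply: nearW => n; exact: (cP n).1.
apply/eqP; rewrite -subr_eq0; apply/eqP; apply: (@norm_le_eps0 _ _ _ 2) => // e e0.
have [n [cn dn]] := limn_half_approx cc e0.
rewrite -(subrKA (f (c n))) mulr_natl mulr2n rmorphD /=.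
apply: le_trans (ler_normD _ _) _; apply: lerD.
  by rewrite -fB fN.
by apply: le_trans (cP n).2 _; rewrite lecR.
Qed.

End isometries.

(** * Lattice approximation on compact spaces *)

Section lattice_approximation.

(** Compactness as an induction principle: the complements of the sets with the
    property generate a filter, which is proper if K lacks it; a cluster point
    has no neighbourhood with the property. *)
Lemma compact_induction (T : topologicalType) (K : set T) (P : set T -> Prop) :
  compact K -> P set0 -> (forall U V, P U -> P V -> P (U `|` V)) ->
  (forall U V, U `<=` V -> P V -> P U) ->
  (forall x, K x -> exists2 U, nbhs x U & P U) -> P K.
Proof.
move=> cK P0 PU Psub Ploc; apply: contrapT => nPK.
pose F : set_system T := [set B | P (K `&` ~` B)].
have FF : ProperFilter F.
  split; first by rewrite /F /= setC0 setIT.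
  split.
  - by rewrite /F /= setCT setI0.
  - by move=> B C FB FC; rewrite /F /= setCI setIUr; exact: PU.
  - by move=> B C BC; apply: Psub => x [Kx Cx]; split=> // /BC.
have [|p [Kp Fp]] := cK F FF; first by rewrite /F /= setICr.
have [U pU PUU] := Ploc p Kp.
have [|x [nUx Ux]] := Fp (~` U) U _ pU; last by [].
by rewrite /F /= setCK; apply: Psub PUU => x [].
Qed.

Context {R : realType} {M : topologicalType} (cM : compact [set: M]).
Implicit Types (f g : M -> R) (L : set (M -> R)).

Lemma near_lt f g x : continuous f -> continuous g -> f x < g x ->
  nbhs x [set z | f z < g z].
Proof.
move=> cf cg fgx; have cB : f z - g z @[z --> x] --> f x - g x.
  by apply: cvgB; [exact: cf|exact: cg].
have /cvgr_lt/(_ 0) := cB; rewrite subr_lt0 => /(_ fgx).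
by apply: filterS => z /=; rewrite subr_lt0.
Qed.

(** For fixed x, minima of interpolating functions stay below f + e everywhere
    and above f - e at x; maxima of these are within e of f. *)
Lemma lattice_approximation L f :
  L !=set0 -> (forall g, L g -> continuous g) ->
  (forall g h, L g -> L h -> L (fun x => Num.min (g x) (h x))) ->
  (forall g h, L g -> L h -> L (fun x => Num.max (g x) (h x))) ->
  continuous f ->
  (forall x y e, 0 < e ->
    exists g, [/\ L g, `|g x - f x| < e & `|g y - f y| < e]) ->
  forall e, 0 < e -> exists2 g, L g & forall x, `|g x - f x| < e.
Proof.
move=> [g0 Lg0] Lc Lmin Lmax cf interp e e0.
have cfe (d : R) : continuous (fun z => f z + d).
  by move=> z; apply: cvgD; [exact: cf|exact: cvg_cst].
have upper x : exists g, [/\ L g, f x - e < g x & forall z, g z < f z + e].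
  suff [g [Lg gx gz]] : exists g, [/\ L g, f x - e < g x
      & forall z, [set: M] z -> g z < f z + e].
    by exists g; split=> // z; exact: gz.
  pose P U := exists g, [/\ L g, f x - e < g x & forall z, U z -> g z < f z + e].
  apply: (@compact_induction _ _ P cM).
  - have [g [Lg gx _]] := interp x x e e0; exists g; split=> //.
    by move: gx; rewrite ltr_distl => /andP[].
  - move=> U V [g [Lg gx gU]] [h [Lh hx hV]].
    exists (fun z => Num.min (g z) (h z)); split; first exact: Lmin.
      by rewrite lt_min gx hx.
    by move=> z [/gU|/hV] zz; rewrite gt_min zz ?orbT.
  - by move=> U V UV [g [Lg gx gV]]; exists g; split=> // z /UV; exact: gV.
  - move=> y _; have [g [Lg gx gy]] := interp x y e e0.
    move: gx gy; rewrite !ltr_distl => /andP[gx _] /andP[_ gy].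
    exists [set z | g z < f z + e]; last by exists g.
    by apply: (@near_lt g (fun z => f z + e)) => //; exact: Lc.
suff [g [Lg gU gl]] : exists g, [/\ L g, forall z, g z < f z + e
    & forall z, [set: M] z -> f z - e < g z].
  by exists g => // x; rewrite ltr_distl gU gl.
pose P U := exists g, [/\ L g, forall z, g z < f z + e
    & forall z, U z -> f z - e < g z].
apply: (@compact_induction _ _ P cM).
- have [[x]|M0] := pselect (exists x : M, True).
    by move=> _; have [g [Lg _ gU]] := upper x; exists g.
  by exists g0; split=> // z; case: M0; exists z.
- move=> U V [g [Lg gx gU]] [h [Lh hx hV]].
  exists (fun z => Num.max (g z) (h z)); split; first exact: Lmax.
    by move=> z; rewrite gt_max gx hx.
  by move=> z [/gU|/hV] zz; rewrite lt_max zz ?orbT.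
- by move=> U V UV [g [Lg gx gV]]; exists g; split=> // z /UV; exact: gV.
- move=> y _; have [g [Lg gy gU]] := upper y.
  exists [set z | f z - e < g z]; last by exists g.
  by apply: (@near_lt (fun z => f z - e) g) => //; exact: Lc.
Qed.

End lattice_approximation.

(** * Continuous functions and isotone functions *)

Section continuous_functions.
Context {R : realType} {M : topologicalType} (cM : compact [set: M]).
Local Notation C := (C_cstar R cM).
Local Notation cval := (@Cval R M cM).
Implicit Types (c d : C) (f g : M -> R).

Definition evaluation (x : M) (c : C) : R[i] := cval c x.

Lemma evaluation_character x : character (evaluation x).
Proof. by split. Qed.

Lemma C_mulC : commutative (fun c d : C => c * d).
Proof. exact: CmulC. Qed.

Lemma norm_Cval c x : `|cval c x| <= `|c|.
Proof. exact: le_Cnorm. Qed.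

Lemma norm_C_le c (t : R) : 0 <= t -> (forall x, `|cval c x| <= t%:C) -> `|c| <= t%:C.
Proof. by move=> t0 ct; apply: Cnorm_le => //; rewrite ler0c. Qed.

Definition real_function f (cf : continuous f) : C :=
  mkC cM (fun x => continuous_comp (cf x) (@real_complex_continuous R (f x))).

Lemma Re_Cval_continuous c : continuous (fun x => complex.Re (cval c x)).
Proof.
by move=> x; apply: continuous_comp; [exact: Cval_continuous|exact: Re_continuous].
Qed.

Lemma Im_Cval_continuous c : continuous (fun x => complex.Im (cval c x)).
Proof.
by move=> x; apply: continuous_comp; [exact: Cval_continuous|exact: Im_continuous].
Qed.

Lemma Cval_meet c d x (s t : R) : cval c x = s%:C -> cval d x = t%:C ->
  cval (cmeet c d) x = (Num.min s t)%:C.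
Proof. exact: (char_meet_real C_mulC (evaluation_character x)). Qed.

Lemma Cval_join c d x (s t : R) : cval c x = s%:C -> cval d x = t%:C ->
  cval (cjoin c d) x = (Num.max s t)%:C.
Proof. exact: (char_join_real C_mulC (evaluation_character x)). Qed.

End continuous_functions.

Section isotone_isocone.
Context {R : realType} (M : compactToposet R).
Local Notation cM := (kt_compact M).
Local Notation C := (C_cstar R cM).
Local Notation cval := (@Cval R M cM).
Local Notation I := (isotone_cone M).

Lemma toposet_separated (x y : M) :
  (forall f, real_isotone R M f -> f x = f y) -> x = y.
Proof.
move=> fxy; apply: le_anti; apply/andP; split.
  by apply: (@kt_toposet R M x y).2 => f /fxy ->.
by apply: (@kt_toposet R M y x).2 => f /fxy ->.
Qed.

Lemma real_isotone_cst (r : R) : real_isotone R M (fun=> r).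
Proof. by split=> // x; exact: cvg_cst. Qed.

Lemma real_isotoneD f g : real_isotone R M f -> real_isotone R M g ->
  real_isotone R M (fun x => f x + g x).
Proof.
move=> [cf hf] [cg hg]; split=> [x|x y xy]; first exact: cvgD (cf x) (cg x).
by rewrite lerD ?hf ?hg.
Qed.

Lemma real_isotoneZ (r : R) f : 0 <= r -> real_isotone R M f ->
  real_isotone R M (fun x => r * f x).
Proof.
move=> r0 [cf hf]; split=> [x|x y xy]; first exact: cvgM (@cvg_cst _ _ _ _ _) (cf x).
by rewrite ler_wpM2l ?hf.
Qed.

Lemma real_isotone_min f g : real_isotone R M f -> real_isotone R M g ->
  real_isotone R M (fun x => Num.min (f x) (g x)).
Proof.
move=> [cf hf] [cg hg]; split=> [x|x y xy].
  by apply: continuous_min; [exact: cf|exact: cg].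
by rewrite le_min !ge_min hf//= hg// orbT.
Qed.

Lemma real_isotone_max f g : real_isotone R M f -> real_isotone R M g ->
  real_isotone R M (fun x => Num.max (f x) (g x)).
Proof.
move=> [cf hf] [cg hg]; split=> [x|x y xy].
  by apply: continuous_max; [exact: cf|exact: cg].
by rewrite ge_max !le_max hf//= hg// orbT.
Qed.

Lemma isotone_cone_pre_isocone : pre_isocone I.
Proof.
split.
- move=> c [f _ cf]; apply: CvalP => x.
  by rewrite -[LHS]/((cval c x)^*)%R cf conjc_realE.
- move=> c cI.
  have approx (e : R) : 0 < e -> exists2 f, real_isotone R M f &
      forall x, `|cval c x - (f x)%:C| <= e%:C.
    move=> e0; have [d [[f fI df] cd]] := cI _ (nbhsx_ballx c (e%:C) ltac:(by rewrite ltcR)).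
    exists f => // x; rewrite -df; apply: le_trans (norm_Cval (c - d) x) _.
    by apply: ltW; move: cd; rewrite -ball_normE.
  exists (fun x => complex.Re (cval c x)).
    split; first exact: Re_Cval_continuous.
    move=> x y xy; apply/ler_addgt0Pr => e e0.
    have [|f [_ hf] fc] := approx (e / 2); first by rewrite divr_gt0.
    have h z : `|complex.Re (cval c z) - f z| <= e / 2.
      rewrite -lecR; apply: le_trans (fc z); apply: le_trans (normc_ge_Re _).
      by case: (cval c z) => ? ?.
    by have := h x; have := h y; have := hf _ _ xy; rewrite !ler_distl; lra.
  move=> x; apply: conjc_real; apply/eqP; rewrite -subr_eq0; apply/eqP.
  apply: (@norm_le_eps0 _ _ _ 2) => // e /approx[f _ /(_ x) fc].
  rewrite -(subrKA ((f x)%:C)) mulr_natl mulr2n rmorphD /=.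
  apply: le_trans (ler_normD _ _) _; apply: lerD; last by rewrite distrC.
  by rewrite -{1}conjc_realE -rmorphB norm_conjC.
- move=> c d [f fI cf] [g gI dg]; exists (fun x => f x + g x).
    exact: real_isotoneD.
  by move=> x; rewrite -[LHS]/(cval c x + cval d x) cf dg rmorphD.
- move=> r c r0 [f fI cf]; exists (fun x => r * f x).
    exact: real_isotoneZ.
  by move=> x; rewrite -[LHS]/(r%:C * cval c x) cf rmorphM.
- move=> c d [f fI cf] [g gI dg]; exists (fun x => Num.min (f x) (g x)).
    exact: real_isotone_min.
  by move=> x; exact: Cval_meet.
- move=> c d [f fI cf] [g gI dg]; exists (fun x => Num.max (f x) (g x)).
    exact: real_isotone_max.
  by move=> x; exact: Cval_join.
- move=> r; exists (fun=> r); first exact: real_isotone_cst.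
  by move=> x; rewrite -[LHS]/(r%:C * 1) mulr1.
Qed.

(** Differences of isotone functions form a lattice: min (g - h, g' - h') is
    min (g + h', g' + h) - (h + h'). They separate points because the order of a
    toposet is antisymmetric, hence interpolate any two values. *)
Lemma isotone_difference_approximation (f : M -> R) (e : R) :
  continuous f -> 0 < e -> exists g h, [/\ real_isotone R M g, real_isotone R M h
    & forall x, `|g x - h x - f x| < e].
Proof.
move=> cf e0.
pose L : set (M -> R) := [set k | exists g h, [/\ real_isotone R M g,
  real_isotone R M h & k = fun x => g x - h x]].
suff [k [g [h [gI hI ->]]] khf] : exists2 k, L k & forall x, `|k x - f x| < e.
  by exists g, h.
apply: lattice_approximation e0 => //; first exact: cM.
- by exists (fun=> 0 - 0), (fun=> 0), (fun=> 0); split=> //; exact: real_isotone_cst.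
- by move=> _ [g [h [[cg _] [ch _] ->]]] x; exact: cvgB (cg x) (ch x).
- move=> _ _ [g [h [gI hI ->]]] [g' [h' [gI' hI' ->]]].
  exists (fun x => Num.min (g x + h' x) (g' x + h x)), (fun x => h x + h' x).
  split; [apply: real_isotone_min; exact: real_isotoneD|exact: real_isotoneD|].
  apply/funext => x; rewrite addr_minl; congr Num.min; ring.
- move=> _ _ [g [h [gI hI ->]]] [g' [h' [gI' hI' ->]]].
  exists (fun x => Num.max (g x + h' x) (g' x + h x)), (fun x => h x + h' x).
  split; [apply: real_isotone_max; exact: real_isotoneD|exact: real_isotoneD|].
  apply/funext => x; rewrite addr_maxl; congr Num.max; ring.
- move=> x y d d0; suff [k [Lk kx ky]] : exists k, [/\ L k, k x = f x & k y = f y].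
    by exists k; rewrite kx ky !subrr normr0.
  have [xy|/eqP xy] := eqVneq x y.
    exists (fun=> f x - 0); rewrite subr0 xy; split=> //.
    by exists (fun=> f y), (fun=> 0); rewrite subr0; split=> //; exact: real_isotone_cst.
  have [h hI hxy] : exists2 h, real_isotone R M h & h x != h y.
    apply: contrapT => nh; apply: xy; apply: toposet_separated => h hI.
    by apply/eqP; apply: contrapT => /negP hxy; apply: nh; exists h.
  (* The affine function of h through both values; the sign of its slope
     decides on which side of the difference h goes. *)
  pose b := (f y - f x) / (h y - h x).
  have bE : b * (h y - h x) = f y - f x.
    by rewrite /b divfK// subr_eq0 eq_sym.
  have [b0|b0] := leP 0 b.
    exists (fun z => (f x - b * h x + b * h z) - 0); split; last 2 first.
    + by ring.
    + by rewrite subr0 -[LHS]addrA -[f y](subrK (f x)) -bE; ring.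
    exists (fun z => f x - b * h x + b * h z), (fun=> 0); split=> //; last exact: real_isotone_cst.
    by apply: real_isotoneD; [exact: real_isotone_cst|exact: real_isotoneZ].
  exists (fun z => (f x - b * h x) - (- b) * h z); split; last 2 first.
  + by ring.
  + by rewrite -[f y](subrK (f x)) -bE; ring.
  exists (fun=> f x - b * h x), (fun z => (- b) * h z); split=> //.
    exact: real_isotone_cst.
  by apply: real_isotoneZ => //; rewrite oppr_ge0 ltW.
Qed.

Lemma isotone_cone_isocone : isocone I.
Proof.
split; first exact: isotone_cone_pre_isocone.
move=> O [c Oc] Oop.
have /nbhs_ballP[_ /complex_gt0_real[e e0 ->] eO] := open_nbhs_nbhs (conj Oop Oc).
have e2 : 0 < e / 2 / 2 by rewrite !divr_gt0.
have [g1 [h1 [g1I h1I fx]]] := isotone_difference_approximation (Re_Cval_continuous (c := c)) e2.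
have [g2 [h2 [g2I h2I fy]]] := isotone_difference_approximation (Im_Cval_continuous (c := c)) e2.
pose E f (fI : real_isotone R M f) : C := real_function cM fI.1.
have EI f (fI : real_isotone R M f) : I (E f fI) by exists f.
pose s : C := 1 *: E _ g1I + (-1) *: E _ h1I + 'i%C *: E _ g2I + (- 'i%C) *: E _ h2I.
exists s; split.
  apply: eO; rewrite -ball_normE /=.
  apply: (@le_lt_trans _ _ ((e / 2)%:C)); last by rewrite ltcR; lra.
  apply: norm_C_le; first by rewrite divr_ge0 ?ltW.
  move=> x.
  have -> : cval (c - s) x = cval c x - (1 * (g1 x)%:C + (-1) * (h1 x)%:C
     + 'i%C * (g2 x)%:C + (- 'i%C) * (h2 x)%:C) by [].
  have := fx x; have := fy x; rewrite [e / 2]splitr rmorphD /=.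
  set d := e / 2 / 2; move=> dy dx.
  have -> : cval c x - (1 * (g1 x)%:C + (-1) * (h1 x)%:C
     + 'i%C * (g2 x)%:C + (- 'i%C) * (h2 x)%:C) =
     - ((g1 x - h1 x - complex.Re (cval c x))%:C
        + 'i%C * (g2 x - h2 x - complex.Im (cval c x))%:C).
    rewrite {1}[cval c x]complexE !rmorphB /=; ring.
  rewrite normrN; apply: le_trans (ler_normD _ _) _.
  by rewrite normrM norm_i mul1r !norm_real_complex lerD// lecR ltW.
exists 4%N, (fun i => nth 0 [:: 1; -1; 'i%C; - 'i%C] i),
  (fun i => nth 0 [:: E _ g1I; E _ h1I; E _ g2I; E _ h2I] i); split.
  by move=> [[|[|[|[|]]]] i4] /=.
by rewrite !big_ord_recr big_ord0 /= add0r.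
Qed.

End isotone_isocone.

(** * Pullbacks along continuous isotone maps *)

Section pullbacks.
Context {R : realType} (M N : compactToposet R) (f : M -> N)
  (cf : continuous f) (fI : isotone f).
Local Notation CM := (C_cstar R (kt_compact M)).
Local Notation CN := (C_cstar R (kt_compact N)).
Local Notation valM := (@Cval R M (kt_compact M)).
Local Notation valN := (@Cval R N (kt_compact N)).
Local Notation pull := (Cpullback cf : CN -> CM).

Lemma Cpullback_star_morphism : star_morphism pull.
Proof.
split=> [k c d||c]; first exact: CvalP.
- by split=> [|c d]; exact: CvalP.
- exact: CvalP.
Qed.

(** g truncated to the band of width d around c. *)
Definition clip (c g : CN) (d : R) : CN :=
  cjoin (cmeet g (c + d%:C *: (1 : CN))) (c + (- d)%:C *: (1 : CN)).

Lemma clip_mem (J : set CN) c g d : pre_isocone J -> J c -> J g -> J (clip c g d).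
Proof.
move=> JP Jc Jg; apply: (isocone_join JP).
  by apply: (isocone_meet JP) => //; apply: (isoconeD JP) => //; exact: isocone_const.
by apply: (isoconeD JP) => //; exact: isocone_const.
Qed.

Lemma clip_val c g d y (s t : R) : valN c y = s%:C -> valN g y = t%:C ->
  valN (clip c g d) y = (Num.max (Num.min t (s + d)) (s - d))%:C.
Proof.
move=> cs gt_; apply: Cval_join.
  apply: Cval_meet => //.
  by rewrite -[LHS]/(valN c y + d%:C * 1) cs mulr1 rmorphD.
by rewrite -[LHS]/(valN c y + (- d)%:C * 1) cs mulr1 rmorphD.
Qed.

(** Members g n of J whose pullbacks converge need not converge on N. Clipping
    g (n + 1) to within the distance of the pullbacks around the previous term
    stays in J, does not change the pullback, and makes the sequence converge in
    norm. *)
Lemma Cpullback_closed_image (J : set CN) : pre_isocone J ->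
  J `<=` isotone_cone N -> closed (pull @` J).
Proof.
move=> JP JI h hJ; pose d n : R := 2^-1 ^+ n.
have d0 n : 0 < d n by rewrite exprn_gt0// invr_gt0.
have dS n : d n.+1 = 2^-1 * d n by rewrite /d exprS.
have /choice[g gP] : forall n, exists g, J g /\ `|pull g - h| <= (d n)%:C.
  move=> n; have [_ [[g Jg <-] hg]] := hJ _ (nbhsx_ballx h ((d n)%:C) ltac:(by rewrite ltcR)).
  by exists g; split=> //; apply: ltW; move: hg; rewrite -ball_normE /= distrC.
pose k : nat -> CN := nat_rect (fun=> CN : Type) (g 0%N)
  (fun n c => clip c (g n.+1) (2 * d n)).
have kS n : k n.+1 = clip (k n) (g n.+1) (2 * d n) by [].
have Jk n : J (k n).
  elim: n => [|n ih]; first exact: (gP 0%N).1.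
  by rewrite kS; apply: clip_mem => //; exact: (gP n.+1).1.
have kg n : pull (k n) = pull (g n).
  elim: n => // n ih; apply: CvalP => x.
  rewrite -[LHS]/(valN (k n.+1) (f x)) -[RHS]/(valN (g n.+1) (f x)) kS.
  have [s _ ks] := JI _ (Jk n); have [t _ gt_] := JI _ (gP n.+1).1.
  rewrite (clip_val _ (ks _) (gt_ _)) gt_; congr (_%:C).
  have : `|s (f x) - t (f x)| <= 2 * d n.
    rewrite -lecR.
    have -> : `|s (f x) - t (f x)|%:C = `|valM (pull (k n) - pull (g n.+1)) x|.
      rewrite -[valM _ x]/(valN (k n) (f x) - valN (g n.+1) (f x)) ks gt_.
      by rewrite -rmorphB norm_real_complex.
    apply: le_trans (norm_Cval (pull (k n) - pull (g n.+1)) x) _.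
    rewrite ih -(subrKA h) mulr_natl mulr2n rmorphD /=.
    apply: le_trans (ler_normD _ _) _; apply: lerD; first exact: (gP n).2.
    rewrite distrC; apply: le_trans (gP n.+1).2 _; rewrite lecR dS.
    by have := d0 n; lra.
  rewrite ler_distl => /andP[h1 h2].
  by rewrite min_l ?max_l//; lra.
have ck : cvgn k.
  apply: (@half_geometric_cvg _ _ _ 2).
  move=> n; rewrite -/(d n); apply: norm_C_le.
    by rewrite mulr_ge0// ltW.
  move=> y; rewrite -[Cval _ y]/(valN (k n.+1) y - valN (k n) y) kS.
  have [s _ ks] := JI _ (Jk n); have [t _ gt_] := JI _ (gP n.+1).1.
  rewrite (clip_val _ (ks _) (gt_ _)) ks -rmorphB norm_real_complex lecR.
  have d2 : 0 < 2 * d n by rewrite mulr_gt0.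
  rewrite ler_distl ge_max ge_min le_max; apply/andP; split.
    by rewrite lexx orbT.
  by rewrite lexx orbT /=; move: d2; lra.
exists (limn k).
  by apply: (closed_cvg J (isocone_closed JP) _ (limn k) ck); apply: nearW.
apply/eqP; rewrite -subr_eq0; apply/eqP; apply: (@norm_le_eps0 _ _ _ 2) => // e e0.
have [n [kn dn]] := limn_half_approx ck e0.
rewrite -(subrKA (pull (k n))) mulr_natl mulr2n rmorphD /=.
apply: le_trans (ler_normD _ _) _; apply: lerD.
  apply: norm_C_le; first exact: ltW.
  move=> x; rewrite -[Cval _ x]/(valN (limn k - k n) (f x)).
  exact: le_trans (norm_Cval _ _) kn.
by rewrite kg; apply: le_trans (gP n).2 _; rewrite lecR.
Qed.

Lemma Cpullback_istar_morphism :
  istar_morphism (isotone_cone N) (isotone_cone M) pull.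
Proof.
split; [exact: Cpullback_star_morphism| |exact: Cpullback_closed_image].
move=> _ [c [g [cg gI] gc] <-]; exists (g \o f); last by move=> x; exact: gc.
split=> [x|x y xy /=]; first by apply: continuous_comp; [exact: cf|exact: cg].
by apply: gI; exact: fI.
Qed.

End pullbacks.

(** * The compact toposet of characters *)

Section character_space_topology.
Context {R : realType} (X : abIstarAlgType R).
Local Notation K := (char_space X).

Lemma char_eval_continuous (a : X) : continuous (fun m : K => sval m a).
Proof.
move=> m.
by have /(@pointwise_cvgP X R[i] _ _ (fmap_filter _ (nbhs_filter m)))/(_ a) :=
  @initial_continuous _ _ (@char_fun R X) m.
Qed.

Lemma Re_char_eval_continuous (a : X) :
  continuous (fun m : K => complex.Re (sval m a)).
Proof.
move=> m; apply: (continuous_comp (f := fun m : K => sval m a)).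
  exact: char_eval_continuous.
exact: Re_continuous.
Qed.

Lemma char_space_hausdorff : hausdorff_space K.
Proof.
move=> m n mn; apply: val_inj_char; apply/funext => a.
apply: (@norm_hausdorff _ R[i]) => U V mU nV.
have [p [pU pV]] := mn _ _ (char_eval_continuous (a := a) mU) (char_eval_continuous (a := a) nV).
by exists (sval p a).
Qed.

Lemma character_limit (H : set_system {ptws X -> R[i]}) (phi : X -> R[i]) :
  ProperFilter H -> H (@character R X) ->
  (forall a, g a @[g --> H] --> phi a) -> character phi.
Proof.
move=> HF Hch Hphi.
have lim_eq (F G : (X -> R[i]) -> R[i]) (x y : R[i]) :
    (forall g, character g -> F g = G g) -> F g @[g --> H] --> x ->
    G g @[g --> H] --> y -> x = y.
  move=> FG Fx Gy; have Fy : F g @[g --> H] --> y.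
    apply: cvg_trans Gy; apply: near_eq_cvg.
    by apply: filterS Hch => g /FG ->.
  by apply: (cvg_unique _ Fx Fy); exact: norm_hausdorff.
split=> [k a b||a].
- apply: (lim_eq (fun g => g (k *: a + b)) (fun g => k * g a + g b)) (Hphi _) _.
    by move=> g gP; rewrite (charD gP) (charZ gP).
  by apply: cvgD (Hphi b); apply: cvgM (Hphi a); exact: cvg_cst.
- split=> [|a b].
    apply: (lim_eq (fun g => g 1) (fun=> 1)) (Hphi _) _; last exact: cvg_cst.
    by move=> g gP; exact: char1.
  apply: (lim_eq (fun g => g (a * b)) (fun g => g a * g b)) (Hphi _) _.
    by move=> g gP; exact: charM.
  exact: cvgM (Hphi a) (Hphi b).
- apply: (lim_eq (fun g => g (star a)) (fun g => (g a)^*%R)) (Hphi _) _.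
    by move=> g gP; exact: char_star.
  apply/cvgrPdist_lt => e e0; have /cvgrPdist_lt/(_ e e0) := Hphi a.
  by apply: filterS => g; rewrite -rmorphB norm_conjC.
Qed.

(** Characters are bounded by the norm, so they lie in a product of compact
    sets; a pointwise limit of characters is a character. *)
Lemma char_space_is_compact : compact [set: K].
Proof.
move=> F FF _.
have /choice[r rP] : forall a : X, exists r : R, `|a| = r%:C.
  by move=> a; have [r _ ar] := norm_real a; exists r.
have /choice[B BP] : forall a : X, exists B : set R[i],
    compact B /\ forall z, `|z| <= (r a)%:C -> B z.
  by move=> a; have [B cB Bz] := complex_box_compact (r a); exists B.
have cB := @tychonoff X (fun=> R[i]) B (fun a => (BP a).1).
pose w : K -> {ptws X -> R[i]} := @char_fun R X.
have [|phi [_ phiF]] := cB (w @ F) (fmap_proper_filter _ FF).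
  apply: (@filterE _ F) => m a; apply: (BP a).2; rewrite -rP.
  exact: character_le (svalP m).
have := phiF; rewrite cluster_cvgE => -[H HF [Hphi FH]].
have phiP : character phi.
  apply: (character_limit HF).
    by apply: FH; apply: (@filterE _ F) => m; exact: svalP.
  exact/(@pointwise_cvgP X R[i] H phi).
exists (exist _ phi phiP); split=> // P U FP [_ [[V Vop <-] Vphi VU]].
have [|_ [[m Pm <-] Vm]] := phiF (w @` P) V _ (open_nbhs_nbhs (conj Vop Vphi)).
  by apply: (@filterS _ F _ P _ _ FP) => m Pm; exists m.
by exists m; split=> //; exact: VU.
Qed.

Lemma char_space_is_toposet : toposet R K.
Proof.
move=> m n; split=> [mn f [_]|fmn]; first exact.
apply/asboolP => c Ic.
have sc_ : star c = c by have [[Isa _ _ _ _ _ _] _] := istar_isocone X; exact: Isa.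
rewrite (char_real (svalP m) sc_) (char_real (svalP n) sc_) lecR.
apply: (fmn (fun p : K => complex.Re (sval p c))); split.
  exact: Re_char_eval_continuous.
move=> p q /asboolP/(_ c Ic).
by rewrite (char_real (svalP p) sc_) (char_real (svalP q) sc_) lecR.
Qed.

End character_space_topology.

Lemma constructions_well_defined (R : realType) : well_defined R.
Proof.
split.
- exact: istar_morphism_compose.
- exact: isotone_cone_isocone.
- by move=> M N f cf fI; exact: Cpullback_istar_morphism.
- exact: char_space_is_compact.
- exact: char_space_is_toposet.
Qed.

(** * The Gelfand transform *)

Section gelfand_transform.
Context {R : realType} (wd : well_defined R) (X : abIstarAlgType R).
Local Notation M := (character_toposet wd X).
Local Notation C := (C_cstar R (kt_compact M)).
Local Notation cval := (@Cval R M (kt_compact M)).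
Local Notation I := (istar_cone X).

Definition gelfand_map (c : X) : C :=
  @mkC R M (kt_compact M) (fun m : char_space X => sval m c)
    (@char_eval_continuous R X c).
Local Notation G := gelfand_map.

Lemma gelfand_star_morphism : star_morphism G.
Proof.
split=> [k a b||a].
- apply: CvalP => m; have mP := svalP (m : char_space X).
  by rewrite -[LHS]/(sval m (k *: a + b)) (charD mP) (charZ mP).
- split=> [|a b]; apply: CvalP => m; have mP := svalP (m : char_space X).
    by rewrite -[LHS]/(sval m 1) (char1 mP).
  by rewrite -[LHS]/(sval m (a * b)) (charM mP).
- apply: CvalP => m; have mP := svalP (m : char_space X).
  by rewrite -[LHS]/(sval m (star a)) (char_star mP).
Qed.

Lemma gelfandB : {morph G : a b / a - b}.
Proof.
move=> a b; apply: CvalP => m; have mP := svalP (m : char_space X).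
by rewrite -[LHS]/(sval m (a - b)) (charB mP).
Qed.

Lemma gelfand_isometry a : `|G a| = `|a|.
Proof.
have [t t0 at_] := norm_real a; have [s s0 gs] := norm_real (G a).
apply/le_anti/andP; split.
  rewrite at_; apply: norm_C_le => // m; rewrite -at_.
  exact: character_le (svalP (m : char_space X)).
rewrite gs; apply: (norm_le_char (@ab_mulC R X)) => // m mP; rewrite -gs.
exact: (norm_Cval (G a) (exist _ m mP : char_space X)).
Qed.

Lemma gelfand_inj : injective G.
Proof.
move=> a b ab; apply/eqP; rewrite -subr_eq0 -normr_le0 -gelfand_isometry gelfandB ab.
by rewrite subrr normr0.
Qed.

Lemma gelfand_closed_image (J : set X) : closed J -> closed (G @` J).
Proof. by apply: closed_isometry_image; [exact: gelfandB|exact: gelfand_isometry]. Qed.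

Lemma istar_cone_star c : I c -> star c = c.
Proof. by have [[Isa _ _ _ _ _ _] _] := istar_isocone X; exact: Isa. Qed.

Lemma gelfand_cone : G @` I `<=` isotone_cone M.
Proof.
move=> _ [c Ic <-]; exists (fun m : char_space X => complex.Re (sval m c)).
  split; first exact: Re_char_eval_continuous.
  move=> m n /asboolP/(_ c Ic).
  by rewrite (char_real (svalP m) (istar_cone_star Ic)) (char_real (svalP n) (istar_cone_star Ic)) lecR.
by move=> m; exact: (char_real (svalP (m : char_space X)) (istar_cone_star Ic)).
Qed.

(** If f x < f y and f is isotone, then y <= x fails, so some c in I increases
    from x to y and a + b c with b >= 0 takes both values; only nonnegative
    slopes are available in a cone. *)
Lemma gelfand_cone_dense (f : M -> R) (e : R) : real_isotone R M f -> 0 < e ->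
  exists2 c, I c & forall m : char_space X, `|sval m c - (f m)%:C| <= e%:C.
Proof.
move=> [cf fI] e0; have [IP _] := istar_isocone X.
pose L : set (M -> R) :=
  [set g | exists2 c, I c & forall m : char_space X, sval m c = (g m)%:C].
have Lcst r : L (fun=> r).
  by exists (r%:C *: (1 : X)); [exact: isocone_const|move=> m; rewrite (char_sc (svalP m))].
suff [g [c Ic cg] gf] : exists2 g, L g & forall m, `|g m - f m| < e.
  exists c => // m; rewrite cg -rmorphB norm_real_complex lecR.
  exact/ltW/gf.
apply: lattice_approximation e0 => //; first exact: kt_compact.
- by exists (fun=> 0).
- move=> g [c Ic cg].
  have -> : g = fun m : char_space X => complex.Re (sval m c).
    by apply/funext => m; rewrite cg.
  exact: Re_char_eval_continuous.
- move=> g h [c Ic cg] [d Id dh]; exists (cmeet c d); first exact: isocone_meet.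
  by move=> m; apply: (char_meet_real (@ab_mulC R X) (svalP m)).
- move=> g h [c Ic cg] [d Id dh]; exists (cjoin c d); first exact: isocone_join.
  by move=> m; apply: (char_join_real (@ab_mulC R X) (svalP m)).
- have lt_interp x y : f x < f y -> exists g, [/\ L g, g x = f x & g y = f y].
    move=> fxy; have : ~ (forall c, I c -> sval (y : char_space X) c <= sval (x : char_space X) c).
      move=> yx; have /fI : (y <= x)%O by exact/asboolP.
      by rewrite leNgt fxy.
    move=> /existsNP[c /not_implyP[Ic cxy]].
    have ev (m : char_space X) := char_real (svalP m) (istar_cone_star Ic).
    pose g (m : char_space X) := complex.Re (sval m c).
    have gxy : g x < g y.
      by rewrite ltNge; apply/negP => gyx; apply: cxy; rewrite (ev x) (ev y) lecR.
    pose b := (f y - f x) / (g y - g x).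
    have bE : b * (g y - g x) = f y - f x by rewrite /b divfK// subr_eq0 gt_eqF.
    have b0 : 0 <= b by rewrite divr_ge0// subr_ge0 ltW.
    exists (fun m => f x - b * g x + b * g m); split.
    - exists ((f x - b * g x)%:C *: (1 : X) + b%:C *: c).
        by apply: (isoconeD IP); [exact: isocone_const|exact: isoconeZ].
      by move=> m; rewrite (charD (svalP m)) (char_sc (svalP m)) (charZ (svalP m)) ev -rmorphM -rmorphD.
    - by rewrite subrK.
    - by rewrite -addrA -[RHS](subrK (f x)) -bE; ring.
  move=> x y d d0.
  suff [g [Lg gx gy]] : exists g, [/\ L g, g x = f x & g y = f y].
    by exists g; rewrite gx gy !subrr normr0.
  have [/lt_interp//|/lt_interp[g [Lg gy gx]]|fxy] := ltgtP (f x) (f y).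
    by exists g.
  by exists (fun=> f x).
Qed.

Lemma gelfand_cone_eq : G @` I = isotone_cone M.
Proof.
apply/seteqP; split; first exact: gelfand_cone.
move=> F [f fI Ff]; have [IP _] := istar_isocone X.
apply: (gelfand_closed_image (isocone_closed IP)) => U.
move=> /nbhs_ballP[_ /complex_gt0_real[e e0 ->] eU].
have e2 : 0 < e / 2 by rewrite divr_gt0.
have [c Ic cf] := gelfand_cone_dense fI e2.
exists (G c); split; first by exists c.
apply: eU; rewrite -ball_normE /=; apply: (@le_lt_trans _ _ ((e / 2)%:C)).
  rewrite distrC; apply: norm_C_le; first exact: ltW.
  move=> m; rewrite -[Cval _ m]/(sval (m : char_space X) c - cval F m) Ff.
  exact: cf.
by rewrite ltcR; lra.
Qed.

(** The range is closed and contains the span of the isotone functions, which is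
    dense. *)
Lemma gelfand_surj F : exists c, G c = F.
Proof.
have [Gl _ _] := gelfand_star_morphism.
have GZ k a : G (k *: a) = k *: G a.
  apply: CvalP => m; have mP := svalP (m : char_space X).
  by rewrite -[LHS]/(sval m (k *: a)) (charZ mP).
have spanG : complex_span (isotone_cone M) `<=` range G.
  move=> _ [n [k [v [vI ->]]]]; elim: n k v vI => [|n ih] k v vI.
    by rewrite big_ord0; exists 0 => //; rewrite -(subrr 0) gelfandB subrr.
  rewrite big_ord_recl.
  have [|b _ <-] := ih (fun i => k (lift ord0 i)) (fun i => v (lift ord0 i)); first by move=> i; exact: vI.
  have := vI ord0; rewrite -gelfand_cone_eq => -[a _ <-].
  by exists (k ord0 *: a + b) => //; rewrite Gl.
have [_ dI] := isotone_isocone wd M.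
suff : range G F by move=> [c _ <-]; exists c.
apply: (gelfand_closed_image closedT) => U.
rewrite nbhsE => -[O [Oop OF] OU].
have [|H [OH Hs]] := dI O _ Oop; first by exists F.
by exists H; split; [exact: spanG|exact: OU].
Qed.

Definition gelfand_inv (F : C) : X := xget 0 [set c | G c = F].
Local Notation Ginv := gelfand_inv.

Lemma gelfand_invK : cancel Ginv G.
Proof. by move=> F; exact: xgetPex (gelfand_surj F). Qed.

Lemma gelfandK : cancel G Ginv.
Proof. by move=> c; apply: gelfand_inj; rewrite gelfand_invK. Qed.

Lemma gelfand_istar_morphism : istar_morphism I (isotone_cone M) G.
Proof.
split; [exact: gelfand_star_morphism|exact: gelfand_cone|].
by move=> J JP _; exact: gelfand_closed_image (isocone_closed JP).
Qed.

Lemma gelfand_inv_istar_morphism : istar_morphism (isotone_cone M) I Ginv.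
Proof.
have [Gl [G1 GM] Gs] := gelfand_star_morphism.
split.
- split=> [k a b||a]; try (apply: gelfand_inj; rewrite gelfand_invK).
  + by rewrite Gl !gelfand_invK.
  + split=> [|a b]; apply: gelfand_inj; first by rewrite gelfand_invK G1.
    by rewrite GM !gelfand_invK.
  + by rewrite Gs gelfand_invK.
- by move=> _ [F + <-]; rewrite -gelfand_cone_eq => -[c Ic <-]; rewrite gelfandK.
- move=> J JP _; apply: closed_isometry_image (isocone_closed JP).
    by move=> a b; apply: gelfand_inj; rewrite gelfandB !gelfand_invK.
  by move=> a; rewrite -gelfand_isometry gelfand_invK.
Qed.

End gelfand_transform.

(** * Characters of an algebra of continuous functions *)

Section evaluation_map.
Context {R : realType} (wd : well_defined R) (M : compactToposet R).
Local Notation C := (C_cstar R (kt_compact M)).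
Local Notation cval := (@Cval R M (kt_compact M)).
Local Notation K := (char_space (isotone_algebra wd M)).

Definition evaluation_map (x : M) : K :=
  exist _ (fun c : C => cval c x) (evaluation_character (kt_compact M) x).

Lemma evaluation_map_continuous : continuous evaluation_map.
Proof.
apply: continuous_comp_initial => x.
apply/(@pointwise_cvgP (isotone_algebra wd M) R[i] _ _ (fmap_filter _ (nbhs_filter x))) => c.
exact: (@Cval_continuous R M (kt_compact M) c x).
Qed.

Lemma evaluation_map_le x y : (evaluation_map x <= evaluation_map y)%O <-> (x <= y)%O.
Proof.
split=> [/asboolP exy|xy].
  apply: (@kt_toposet R M x y).2 => f fI; rewrite -lecR.
  by apply: (exy (real_function (kt_compact M) fI.1)); exists f.
apply/asboolP => c [f [_ fI] cf] /=.
by rewrite !cf lecR fI.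
Qed.

(** A function without zeros is invertible, so no character vanishes on it. *)
Lemma kernel_zero (m : C -> R[i]) c : character m -> m c = 0 -> exists x, cval c x = 0.
Proof.
move=> mP mc; apply: contrapT => nz.
have cV : continuous (fun x => (cval c x)^-1).
  move=> x; apply: cvgV; last exact: Cval_continuous.
  by apply/eqP => cx; apply: nz; exists x.
have : c * (mkC (kt_compact M) cV : C) = 1.
  apply: CvalP => x; rewrite -[LHS]/(cval c x * (cval c x)^-1) mulfV//.
  by apply/eqP => cx; apply: nz; exists x.
move=> /(congr1 m); rewrite (charM mP) (char1 mP) mc mul0r => /eqP.
by rewrite eq_sym oner_eq0.
Qed.

(** The zero sets of the nonnegative functions in the kernel of m form a filter
    base, and a point p common to all of them works: |c - m c|^2 is in the
    kernel, so it vanishes at p. *)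
Lemma character_evaluation (m : C -> R[i]) : character m ->
  exists x, forall c : C, m c = cval c x.
Proof.
move=> mP; pose Z (c : C) : set M := [set x | cval c x = 0].
pose D : set C := [set c | m c = 0 /\ forall x, 0 <= cval c x].
have D0 : D 0 by split; [exact: char0|].
have FF : ProperFilter (filter_from D Z).
  apply: filter_from_proper; last by move=> c [mc _]; exact: kernel_zero mc.
  apply: filter_from_filter; first by exists 0.
  move=> c d [mc c0] [md d0]; exists (c + d).
    split; first by rewrite (charD mP) mc md addr0.
    by move=> x; exact: (addr_ge0 (c0 x) (d0 x)).
  move=> x cdx; have /eqP : cval c x + cval d x = 0 := cdx.
  by rewrite paddr_eq0// => /andP[/eqP ? /eqP ?].
have [|p [_ pF]] := @kt_compact R M _ FF; first by exists 0.
have pZ c : D c -> cval c p = 0.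
  move=> Dc; apply: (@norm_le_eps0 _ _ _ 1) => // e e0.
  have pB : nbhs p [set x | `|cval c p - cval c x| < e%:C].
    have /(cvgrPdist_lt (FF := nbhs_filter p))/(_ e%:C) :=
      @Cval_continuous R M (kt_compact M) c p.
    by apply; rewrite ltcR.
  have [|x [cx]] := pF (Z c) _ _ pB; first by exists c.
  by rewrite /= cx subr0 mul1r => /ltW.
exists p => c; pose d : C := c - sc (m c).
have md : m d = 0 by rewrite (charB mP) (char_sc mP) subrr.
have Dd : D (star d * d).
  split; first by rewrite (char_norm_sqr mP) md normr0 expr0n.
  move=> x; have xP := @evaluation_character R M (kt_compact M) x.
  by have := char_norm_sqr xP d; rewrite /evaluation => ->; exact: exprn_ge0.
have pP := @evaluation_character R M (kt_compact M) p.
have dE : evaluation p d = cval c p - m c by rewrite (charB pP) (char_sc pP).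
have /eqP : `|evaluation p d| ^+ 2 = 0 := etrans (esym (char_norm_sqr pP d)) (pZ _ Dd).
by rewrite dE expf_eq0 normr_eq0 subr_eq0 => /eqP ->.
Qed.

Lemma evaluation_map_surj (m : K) : exists x, evaluation_map x = m.
Proof.
have [x mx] := character_evaluation (svalP m); exists x.
by apply: val_inj_char; apply/funext => c; rewrite mx.
Qed.

Lemma evaluation_map_inj : injective evaluation_map.
Proof.
by move=> x y xy; apply: le_anti; apply/andP; split;
  apply/evaluation_map_le; rewrite xy.
Qed.

Definition evaluation_inv (m : K) : M := sval (cid (evaluation_map_surj m)).

Lemma evaluation_invK : cancel evaluation_inv evaluation_map.
Proof. by move=> m; rewrite /evaluation_inv; case: cid. Qed.

Lemma evaluation_mapK : cancel evaluation_map evaluation_inv.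
Proof. by move=> x; apply: evaluation_map_inj; rewrite evaluation_invK. Qed.

Lemma evaluation_inv_continuous : continuous evaluation_inv.
Proof.
apply/continuous_closedP => F cF.
have -> : evaluation_inv @^-1` F = evaluation_map @` F.
  apply/seteqP; split=> [m Fm|_ [x Fx <-]] /=.
    by exists (evaluation_inv m) => //; exact: evaluation_invK.
  by rewrite evaluation_mapK.
apply: compact_closed; first exact: char_space_hausdorff.
apply: continuous_compact; first exact: continuous_subspaceT evaluation_map_continuous.
exact: subclosed_compact cF (@kt_compact R M) _.
Qed.

Lemma evaluation_inv_isotone : isotone (evaluation_inv : character_toposet wd _ -> M).
Proof.
by move=> m n mn; apply/evaluation_map_le; rewrite !evaluation_invK.
Qed.

Definition evaluation_hom : KT_hom M (character_toposet wd (isotone_algebra wd M)) :=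
  exist _ evaluation_map
    (conj evaluation_map_continuous (fun x y => (evaluation_map_le x y).2)).

Definition evaluation_inv_hom :
    KT_hom (character_toposet wd (isotone_algebra wd M)) M :=
  exist _ evaluation_inv (conj evaluation_inv_continuous evaluation_inv_isotone).

End evaluation_map.

(** * The duality *)

(** Naturality is an evaluation on both sides; the inverses are natural because
    the Gelfand transform and the evaluation map are injective. *)
Theorem proposition20 (R : realType) :
  exists wd : well_defined R,
    dual_equivalence (character_functor wd) (isotone_functor wd).
Proof.
pose wd := constructions_well_defined R; exists wd; split.
- exists (fun X => exist _ _ (gelfand_inv_istar_morphism wd X)),
    (fun X => exist _ _ (gelfand_istar_morphism wd X)).
  split=> [X|X|X Y f].
  + by apply: abIC_homP => F; exact: gelfand_invK.
  + by apply: abIC_homP => c; exact: gelfandK.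
  + apply: abIC_homP => F; apply: (@gelfand_inj R wd Y) => /=.
    rewrite gelfand_invK -{1}(gelfand_invK F).
    exact: CvalP.
- exists (fun M => evaluation_inv_hom wd M), (fun M => evaluation_hom wd M).
  split=> [M|M|M N f].
  + by apply: KT_homP => m; exact: evaluation_invK.
  + by apply: KT_homP => x; exact: evaluation_mapK.
  + apply: KT_homP => m; apply: (@evaluation_map_inj R wd N) => /=.
    rewrite evaluation_invK -{1}(evaluation_invK m).
    by apply: val_inj_char; apply/funext.
Qed.
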